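(* Let $E$ be a simple finite-dimensional $\mathbf{Q}$-algebra with a positive involution. Every rational $\mathbf{C}$-representation of $E$ is isomorphic to a direct sum of copies of $V_r(E)$, and there is a unique (up to isomorphism) rational and polarized $\mathbf{C}$-representation $V_{rp}(E)$ such that every rational and polarized $\mathbf{C}$-representation of $E$ is isomorphic to a direct sum of copies of $V_{rp}(E)$. Moreover $\dim_{\mathbf{C}}V_r(E)=\deg E$; $V_{rp}(E)\simeq V_r(E)$ if $E$ is of type III or IV; and $V_{rp}(E)\simeq V_r(E)^2$ if $E$ is of type I or II.
   Context: Write $E\simeq\mathrm{M}_n(D)$ with $D$ a division algebra with center $F$, $d^2=[D:F]$, $f=[F:\mathbf{Q}]$, and $\deg E=ndf$. A positive involution is a $\mathbf{Q}$-linear anti-automorphism $*$ of order dividing 2 with $\operatorname{Tr}_E(xx^* )>0$ for $x\neq0$. A $\mathbf{C}$-representation of $E$ is a $\mathbf{Q}$-algebra map $\rho\colon E\to\operatorname{End}_{\mathbf{C}}V$; its simple ones $V_1,\dots,V_f$ correspond to the embeddings $\sigma_1,\dots,\sigma_f\colon F\to\mathbf{C}$ ($V_i$ being the one whose central trace $F\to\mathbf{C}$ is a multiple of $\sigma_i$), and $V_r(E)=\bigoplus_{i=1}^f V_i$. A $\mathbf{C}$-representation is rational if all characteristic polynomials of $\rho(x)$ have coefficients in $\mathbf{Q}$, and polarized if there is a nondegenerate alternating form $B$ on $V$ with $B(\rho(x)v,w)=B(v,\rho(x^* )w)$ for all $x,v,w$. Albert types I–IV: type I: $D=F$ totally real;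 type II/III: $D$ a quaternion algebra over totally real $F$ with $D\otimes_{F,\sigma}\mathbf{R}\simeq\mathrm{M}_2(\mathbf{R})$ (type II), resp. $\simeq\mathbf{H}$ (type III), for all real $\sigma$; type IV: $F$ a CM field (with conditions on local invariants). *)

(* Defs.v *)
From HB Require Import structures.
From mathcomp Require Import all_boot all_order all_algebra all_field.
From mathcomp Require Import reals complex ring.

Set Implicit Arguments.
Unset Strict Implicit.
Unset Printing Implicit Defensive.

Import Order.TTheory GRing.Theory Num.Theory.
Local Open Scope ring_scope.

(** * Simple Q-algebras and positive involutions *)

Definition simple_algebra (E : falgType rat) : Prop :=
  forall I : {vspace E},
    (forall a x, x \in I -> (a * x \in I) && (x * a \in I)) ->
    I = 0%VS \/ I = {:E}%VS.

(* The trace over Q of left multiplication by x.  For E = M_n(D) it is nd times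
   the reduced trace from E to Q, so either trace gives the same positivity
   condition. *)
Definition regular_trace (E : falgType rat) (x : E) : rat :=
  \sum_i coord (vbasis {:E}) i (x * (vbasis {:E})`_i).

Definition positive_involution (E : falgType rat) (star : {linear E -> E}) :
    Prop :=
  [/\ forall x y, star (x * y) = star y * star x,
      forall x, star (star x) = x
    & forall x, x != 0 -> 0 < regular_trace (x * star x)].

(** * Complex representations *)

(* A C-representation on V = C^m (column vectors).  'M_0 is the zero ring, so
   the zero representation is included; a ring morphism between Q-algebras is
   automatically Q-linear. *)
Record crep (R : realType) (E : falgType rat) := CRep {
  rdim : nat;
  rmap :> {rmorphism E -> 'M[R[i]]_rdim}
}.

Section Representations.

Variables (R : realType) (E : falgType rat).
Implicit Types V W : crep R E.

Definition rep_iso V W : Prop :=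
  exists (P : 'M_(rdim V, rdim W)) (Q : 'M_(rdim W, rdim V)),
    [/\ P *m Q = 1%:M, Q *m P = 1%:M & forall x, V x *m P = P *m W x].

Section DirectSum.

Variables (k : nat) (W : 'I_k -> crep R E).

Definition dsum_fun (x : E) : 'M[R[i]]_(\sum_i rdim (W i)) := \mxdiag_i (W i x).

Fact dsum_zmod_morphism : zmod_morphism dsum_fun.
Proof.
move=> x y; rewrite /dsum_fun -mxdiagB; apply/eq_mxdiagP => i.
by rewrite rmorphB.
Qed.

Fact dsum_monoid_morphism : monoid_morphism dsum_fun.
Proof.
split=> [|x y]; rewrite /dsum_fun.
  by rewrite -[RHS](@mxdiagZ _ _ (fun i => rdim (W i)) 1);
     apply/eq_mxdiagP => i; rewrite rmorph1.
rewrite [RHS]mul_mxdiag_mxblock; apply/eq_mxblockP => i j.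
by case: eqVneq => [<-|_]; rewrite ?conform_mx_id ?rmorphM ?mulmx0.
Qed.

HB.instance Definition _ :=
  GRing.isZmodMorphism.Build E 'M[R[i]]_(\sum_i rdim (W i)) dsum_fun
    dsum_zmod_morphism.
HB.instance Definition _ :=
  GRing.isMonoidMorphism.Build E 'M[R[i]]_(\sum_i rdim (W i)) dsum_fun
    dsum_monoid_morphism.

Definition dsum : crep R E := CRep dsum_fun.

End DirectSum.

Definition copies V (k : nat) : crep R E := dsum (fun _ : 'I_k => V).

Definition simple_rep V : Prop :=
  (0 < rdim V)%N /\
  forall U : {vspace 'cV[R[i]]_(rdim V)},
    (forall x v, v \in U -> V x *m v \in U) -> U = 0%VS \/ U = fullv.

Definition rational_rep V : Prop :=
  forall x, exists p : {poly rat}, char_poly (V x) = map_poly ratr p.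

Definition bform n (M : 'M[R[i]]_n) (v w : 'cV[R[i]]_n) : R[i] :=
  (v^T *m M *m w) 0 0.

Definition polarized_rep (star : {linear E -> E}) V : Prop :=
  exists M : 'M[R[i]]_(rdim V),
    [/\ forall v, bform M v v = 0,
        forall v, (forall w, bform M v w = 0) -> v = 0
      & forall x v w, bform M (V x *m v) w = bform M v (V (star x) *m w)].

(* The center of E, identified with the center F of D when E = M_n(D). *)
Definition algebra_center := subvs_of 'Z({:E})%AS.

Definition central_trace_multiple
    (sigma : {rmorphism algebra_center -> R[i]}) V : Prop :=
  exists c : R[i], forall z : algebra_center, \tr (V (vsval z)) = c * sigma z.

Definition is_Vr V : Prop :=
  let f := \dim ('Z({:E}))%VS in
  exists (sigma : 'I_f -> {rmorphism algebra_center -> R[i]})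
         (W : 'I_f -> crep R E),
    [/\ forall tau : {rmorphism algebra_center -> R[i]},
          exists! i, sigma i =1 tau,
        forall i, simple_rep (W i),
        forall i, central_trace_multiple (sigma i) (W i)
      & rep_iso V (dsum W)].

Definition is_Vrp (star : {linear E -> E}) V : Prop :=
  [/\ rational_rep V, polarized_rep star V
    & forall W, rational_rep W -> polarized_rep star W ->
        exists k, rep_iso W (copies V k)].

End Representations.

(** * Hamilton quaternions *)

Definition quaternion (R : realType) := 'rV[R]_4.

Section Quaternion.

Variable R : realType.
Local Notation H := (quaternion R).

HB.instance Definition _ := Vector.on H.

Definition quat (a b c d : R) : H := \row_(j < 4) [:: a; b; c; d]`_j.

Definition qc (x : H) (j : nat) : R := x 0 (inord j).

(* Coordinates with respect to 1, i, j, k with i^2 = j^2 = -1, ij = -ji = k. *)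
Definition quat_mul (x y : H) : H :=
  quat (qc x 0 * qc y 0 - qc x 1 * qc y 1 - qc x 2 * qc y 2 - qc x 3 * qc y 3)
       (qc x 0 * qc y 1 + qc x 1 * qc y 0 + qc x 2 * qc y 3 - qc x 3 * qc y 2)
       (qc x 0 * qc y 2 - qc x 1 * qc y 3 + qc x 2 * qc y 0 + qc x 3 * qc y 1)
       (qc x 0 * qc y 3 + qc x 1 * qc y 2 - qc x 2 * qc y 1 + qc x 3 * qc y 0).

Fact qcE a b c d j : (j < 4)%N -> qc (quat a b c d) j = [:: a; b; c; d]`_j.
Proof. by move=> ltj; rewrite /qc /quat mxE inordK. Qed.

Fact qcD x y j : qc (x + y) j = qc x j + qc y j.
Proof. by rewrite /qc mxE. Qed.

Fact qcZ (a : R) (x : H) j : qc (a *: x) j = a * qc x j.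
Proof. by rewrite /qc mxE. Qed.

Fact quatP (x y : H) :
  [/\ qc x 0 = qc y 0, qc x 1 = qc y 1, qc x 2 = qc y 2 & qc x 3 = qc y 3] ->
  x = y.
Proof.
case=> h0 h1 h2 h3; apply/rowP => i.
have: qc x i = qc y i by case: i => [[|[|[|[|//]]]] lti].
by rewrite /qc inord_val.
Qed.

Fact quat_mulA : associative quat_mul.
Proof. by move=> x y z; apply: quatP; rewrite /quat_mul !qcE //=; split; ring. Qed.

Fact quat_mul1 : left_id (quat 1 0 0 0) quat_mul.
Proof. by move=> x; apply: quatP; rewrite /quat_mul !qcE //=; split; ring. Qed.

Fact quat_1mul : right_id (quat 1 0 0 0) quat_mul.
Proof. by move=> x; apply: quatP; rewrite /quat_mul !qcE //=; split; ring. Qed.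

Fact quat_mulDl : left_distributive quat_mul +%R.
Proof.
by move=> x y z; apply: quatP; rewrite /quat_mul !(qcD, qcE) //=; split; ring.
Qed.

Fact quat_mulDr : right_distributive quat_mul +%R.
Proof.
by move=> x y z; apply: quatP; rewrite /quat_mul !(qcD, qcE) //=; split; ring.
Qed.

Fact quat_1neq0 : quat 1 0 0 0 != 0.
Proof.
apply/eqP => /(congr1 (fun x : H => qc x 0)).
by rewrite qcE //= /qc mxE => /eqP; rewrite oner_eq0.
Qed.

HB.instance Definition _ := GRing.Zmodule_isNzRing.Build H
  quat_mulA quat_mul1 quat_1mul quat_mulDl quat_mulDr quat_1neq0.

Fact quat_scaleAl (a : R) (x y : H) : a *: (x * y) = a *: x * y.
Proof.
by apply: quatP; rewrite /GRing.mul /= /quat_mul !(qcZ, qcE) //=; split; ring.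
Qed.

HB.instance Definition _ := GRing.Lmodule_isLalgebra.Build R H quat_scaleAl.

Fact quat_scaleAr (a : R) (x y : H) : a *: (x * y) = x * (a *: y).
Proof.
by apply: quatP; rewrite /GRing.mul /= /quat_mul !(qcZ, qcE) //=; split; ring.
Qed.

HB.instance Definition _ := GRing.Lalgebra_isAlgebra.Build R H quat_scaleAr.
HB.instance Definition _ := Algebra_isFalgebra.Build R H.

End Quaternion.

(** * Albert types *)

(* E = M_n(D), with D a division algebra with center F. *)
Definition wedderburn (E : falgType rat) (F : fieldExtType rat)
    (D : falgType F) (n : nat) (g : {rmorphism 'M[D]_n -> E}) : Prop :=
  [/\ forall x : D, x != 0 -> x \is a GRing.unit,
      'Z({:D})%VS = 1%VS
    & bijective g].

(* D \otimes_{F, sigma} L is isomorphic to A as an L-algebra: the isomorphism is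
   x \otimes l |-> l *: phi x, and it is bijective iff phi sends F-bases of D to
   L-bases of A. *)
Definition base_change_iso (F L : fieldType) (sigma : {rmorphism F -> L})
    (D : falgType F) (A : falgType L) : Prop :=
  exists phi : {rmorphism D -> A},
    (forall a x, phi (a *: x) = sigma a *: phi x) /\
    (forall b : seq D, basis_of {:D}%VS b -> basis_of {:A}%VS (map phi b)).

Definition totally_real (R : realType) (F : fieldExtType rat) : Prop :=
  forall (tau : {rmorphism F -> R[i]}) (a : F), tau a \is Num.real.

Definition totally_imaginary (R : realType) (F : fieldExtType rat) : Prop :=
  forall tau : {rmorphism F -> R[i]}, exists a : F, tau a \isn't Num.real.

Definition CM_field (R : realType) (F : fieldExtType rat) : Prop :=
  totally_imaginary R F /\
  exists K : {subfield F},
    totally_real R (subvs_of K) /\ (\dim {:F} = 2 * \dim K)%N.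

Definition div_type_I (R : realType) (F : fieldExtType rat) (D : falgType F) :
    Prop :=
  totally_real R F /\ \dim {:D} = 1%N.

Definition div_type_II (R : realType) (F : fieldExtType rat) (D : falgType F) :
    Prop :=
  [/\ totally_real R F, \dim {:D} = 4
    & forall sigma : {rmorphism F -> R}, base_change_iso sigma D 'M[R]_2].

Definition div_type_III (R : realType) (F : fieldExtType rat) (D : falgType F) :
    Prop :=
  [/\ totally_real R F, \dim {:D} = 4
    & forall sigma : {rmorphism F -> R}, base_change_iso sigma D (quaternion R)].

(* The conditions on the local invariants of D in type IV are necessary and
   sufficient for M_n(D) to carry an involution inducing complex conjugation on
   the CM field F.  They hold automatically when M_n(D) has a positive
   involution, so they are not repeated here. *)
Definition div_type_IV (R : realType) (F : fieldExtType rat) (D : falgType F) :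
    Prop :=
  CM_field R F.

Definition of_type
    (T : forall F : fieldExtType rat, falgType F -> Prop) (E : falgType rat) :
    Prop :=
  exists (F : fieldExtType rat) (D : falgType F) (n : nat)
         (g : {rmorphism 'M[D]_n -> E}),
    wedderburn g /\ T F D.

Definition type_I (R : realType) := of_type (@div_type_I R).
Definition type_II (R : realType) := of_type (@div_type_II R).
Definition type_III (R : realType) := of_type (@div_type_III R).
Definition type_IV (R : realType) := of_type (@div_type_IV R).

(* Main.v *)
From HB Require Import structures.
Require Import Defs.
From mathcomp Require Import all_boot all_order all_algebra all_field.
From mathcomp Require Import reals complex ring zify.
From mathcomp Require boolp.

Set Implicit Arguments.
Unset Strict Implicit.
Unset Printing Implicit Defensive.

Import Order.TTheory GRing.Theory Num.Theory.
Local Open Scope ring_scope.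

(** Let T be the regular trace. Positivity makes the form T(xy) nondegenerate,
    and a pair of dual bases e, e' for it plays the role of group averaging:
    P |-> sum_k W(e_k) P V(e'_k) projects Hom_C(V, W) onto the intertwiners, so
    representations are semisimple, are determined by their traces, and
    dim Hom_E(V, W) is a pairing of traces. The central characters of the simple
    representations V_i are exactly the embeddings sigma_i of the center Z. If
    sum_i t_i sigma_i is rational-valued with rational t_i, then it is of the
    form T(a z) with a in Z, so sigma_i(a) = t_i / (dim V_i)^2 is rational; as Z
    is a field, a is rational and t_i / (dim V_i)^2 does not depend on i. With
    t_i = 1 this shows that the dim V_i are equal, and with t_i = m_i dim V_i
    that a rational representation contains all V_i equally often.

    A polarized representation contains every simple representation with a
    symmetric invariant form an even number of times, while V + V^* is always
    polarized. Hence V_rp is V_r if V_r is polarized and V_r^2 otherwise, and V_r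
    is polarized as soon as all its self-dual simple constituents are. Positivity
    yields on each V an invariant hermitian form H. In types I and II a simple
    representation has a real model, and H + H^T is symmetric invariant; in type
    III it has a quaternionic structure J, and the alternating part of J^T H is
    invariant and nonzero; in type IV sigma(z^* ) is the complex conjugate of
    sigma(z), so no simple representation is self-dual. *)

(** * The trace form *)

Section TraceForm.

Variable E : falgType rat.
Local Notation T := (@regular_trace E).

Fact regular_trace_is_linear : scalar T.
Proof.
move=> a x y; rewrite /regular_trace mulr_sumr -big_split /=.
by apply: eq_bigr => i _; rewrite mulrDl -scalerAl linearP.
Qed.

HB.instance Definition _ :=
  GRing.isLinear.Build rat E rat^o *%R T regular_trace_is_linear.

Lemma coord_fullv (x : E) :
  x = \sum_i coord (vbasis {:E}) i x *: (vbasis {:E})`_i.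
Proof. by apply: coord_vbasis; rewrite memvf. Qed.

(** With [c z] the matrix of left multiplication by [z], this is the cyclicity of the matrix
    trace. *)
Lemma regular_traceC (x y : E) : T (x * y) = T (y * x).
Proof.
rewrite /regular_trace.
pose c (z : E) (j i : 'I_(\dim {:E})) :=
  coord (vbasis {:E}) j (z * (vbasis {:E})`_i).
have cE u v i : coord (vbasis {:E}) i (u * v * (vbasis {:E})`_i) =
    \sum_j c v j i * c u i j.
  rewrite -mulrA {1}(coord_fullv (v * _)) mulr_sumr linear_sum.
  by apply: eq_bigr => j _; rewrite -scalerAr linearZ.
under eq_bigr do rewrite cE; under [RHS]eq_bigr do rewrite cE.
by rewrite exchange_big; apply: eq_bigr => i _; apply: eq_bigr => j _;
   rewrite mulrC.
Qed.

Definition trace_nondegenerate :=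
  forall x : E, (forall y, T (x * y) = 0) -> x = 0.

(** Only the expansion of every [x] is asked for. The sum of the tensors of [e k] with [e' k] is
    then the Casimir element of the trace form. *)
Definition dual_bases n (e e' : 'I_n -> E) :=
  forall x, x = \sum_k T (x * e' k) *: e k.

Hypothesis ndT : trace_nondegenerate.

Lemma eq_by_trace (x y : E) : (forall z, T (z * x) = T (z * y)) -> x = y.
Proof.
move=> eqT; apply/eqP; rewrite -subr_eq0; apply/eqP/ndT => z.
by rewrite regular_traceC mulrBr linearB /= eqT subrr.
Qed.

Lemma dual_bases_sym n (e e' : 'I_n -> E) : dual_bases e e' ->
  forall x, x = \sum_k T (e k * x) *: e' k.
Proof.
move=> dual_e x; apply: eq_by_trace => z.
rewrite {1}(dual_e z) mulr_suml mulr_sumr !linear_sum /=.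
by apply: eq_bigr => k _; rewrite -scalerAl -scalerAr !linearZ /= mulrC.
Qed.

Lemma zmod_morphism_sum (U A : zmodType) (f : U -> A) (fB : zmod_morphism f)
    I (r : seq I) (F : I -> U) : f (\sum_(i <- r) F i) = \sum_(i <- r) f (F i).
Proof.
pose g : {additive U -> A} := HB.pack f (GRing.isZmodMorphism.Build _ _ f fB).
exact: (raddf_sum g).
Qed.

Section Balanced.

Variables (A : zmodType) (b : E -> E -> A).
Hypotheses (bBl : forall y, zmod_morphism (b ^~ y))
           (bBr : forall x, zmod_morphism (b x))
           (bZ : forall q x y, b (q *: x) y = b x (q *: y)).

(** A balanced biadditive [b] is a map on the tensor square of [E] over the rationals. Each [f k] is
    expanded along [e], and the rational coefficients are moved across to the second argument. *)
Lemma casimir_change m n (f : 'I_m -> E) (e e' : 'I_n -> E) (g : 'I_m -> E) :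
    dual_bases e e' ->
  \sum_k b (f k) (g k) = \sum_l b (e l) (\sum_k T (f k * e' l) *: g k).
Proof.
move=> dual_e; under eq_bigr => k _.
  rewrite {1}(dual_e (f k)) (zmod_morphism_sum (bBl _)).
  under eq_bigr do rewrite bZ.
  over.
by rewrite exchange_big; apply: eq_bigr => l _; rewrite zmod_morphism_sum.
Qed.

(** Left and right multiplication by [x] agree on the Casimir element: by cyclicity of the trace,
    the coefficient of [x * e k] along [e l] is the coefficient of [e' l * x] along [e' k]. *)
Lemma casimirM n (e e' : 'I_n -> E) x : dual_bases e e' ->
  \sum_k b (x * e k) (e' k) = \sum_k b (e k) (e' k * x).
Proof.
move=> dual_e; rewrite (casimir_change _ _ dual_e); apply: eq_bigr => l _.
rewrite [e' l * x](dual_bases_sym dual_e); congr (b _ _).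
by apply: eq_bigr => k _; rewrite [in RHS]mulrA -[in LHS]mulrA regular_traceC.
Qed.

Lemma casimir_indep m n (f f' : 'I_m -> E) (e e' : 'I_n -> E) :
  dual_bases e e' -> dual_bases f f' ->
  \sum_k b (f k) (f' k) = \sum_k b (e k) (e' k).
Proof.
move=> dual_e dual_f; rewrite (casimir_change _ _ dual_e).
by apply: eq_bigr => l _; rewrite -(dual_bases_sym dual_f).
Qed.

End Balanced.

(** Nondegeneracy makes the Gram matrix [G] of a basis invertible, and the columns of its inverse
    give the dual basis. *)
Lemma dual_vbasis :
  {e' : 'I_(\dim {:E}) -> E | dual_bases (fun k => (vbasis {:E})`_k) e'}.
Proof.
set n := \dim {:E}; pose e (k : 'I_n) := (vbasis {:E})`_k.
pose G := \matrix_(k < n, l < n) T (e k * e l).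
have Gunit : G \in unitmx.
  rewrite -row_free_unit -kermx_eq0; apply/rowV0P => v /sub_kermxP vG0.
  have x0 : \sum_k v 0 k *: e k = 0.
    apply: ndT => y; rewrite (coord_fullv y) mulr_sumr linear_sum big1 // => l _.
    rewrite -scalerAr linearZ /=; suff -> : T ((\sum_k v 0 k *: e k) * e l) = 0.
      by rewrite mulr0.
    have := congr1 (fun A : 'rV_n => A 0 l) vG0; rewrite !mxE => <-.
    rewrite mulr_suml linear_sum; apply: eq_bigr => k _.
    by rewrite -scalerAl linearZ /= mxE.
  apply/rowP => k; rewrite mxE; have /freeP free_e := basis_free (vbasisP {:E}).
  exact: (free_e (fun k => v 0 k) x0).
exists (fun k => \sum_l invmx G l k *: e l) => x.
rewrite [LHS]coord_fullv; apply: eq_bigr => k _; congr (_ *: _).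
rewrite {2}(coord_fullv x) mulr_suml linear_sum /=.
transitivity (\sum_i coord (vbasis {:E}) i x * (G *m invmx G) i k); last first.
  apply: eq_bigr => i _; rewrite -scalerAl linearZ /=; congr (_ * _).
  rewrite mxE [X in T X]mulr_sumr linear_sum /=; apply: eq_bigr => l _.
  by rewrite -scalerAr linearZ /= mxE mulrC.
rewrite mulmxV // (bigD1 k) //= mxE eqxx mulr1 big1 ?addr0 // => i ik.
by rewrite mxE (negPf ik) mulr0.
Qed.

Lemma balanced_mul (u : E) : let b x y := x * u * y in
  [/\ forall y, zmod_morphism (b ^~ y), forall x, zmod_morphism (b x)
    & forall q x y, b (q *: x) y = b x (q *: y)].
Proof.
split=> [y x x'|x y y'|q x y]; first by rewrite !mulrBl.
  by rewrite !mulrBr.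
by rewrite -!scalerAl -scalerAr.
Qed.

(** By [casimir_indep] the sum may be computed on an actual basis. Multiplied by [z], its trace
    collects the diagonal coordinates of left multiplication by [z], which is [T z]: the
    normalization of the regular trace is what produces 1. *)
Lemma casimir_unit n (e e' : 'I_n -> E) : dual_bases e e' ->
  \sum_k e k * e' k = 1.
Proof.
move=> dual_e; have [e1' dual_e1] := dual_vbasis.
have [bBl bBr bZ] := balanced_mul 1.
have := casimir_indep bBl bBr bZ dual_e1 dual_e.
under eq_bigr do rewrite mulr1; under [in RHS]eq_bigr do rewrite mulr1.
move=> ->; apply: eq_by_trace => z; rewrite mulr1 mulr_sumr linear_sum /=.
apply: eq_bigr => k _; rewrite mulrA.
set x := z * _; rewrite [in RHS](dual_e1 x) linear_sum (bigD1 k) //= linearZ /=.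
have free_e := basis_free (vbasisP {:E}).
rewrite (coord_free _ _ free_e) eqxx mulr1 big1 ?addr0 // => i ik.
by rewrite linearZ /= (coord_free _ _ free_e) (negPf ik) mulr0.
Qed.

Lemma dual_basesC n (e e' : 'I_n -> E) : dual_bases e e' -> dual_bases e' e.
Proof.
by move=> dual_e x; rewrite [LHS](dual_bases_sym dual_e);
   apply: eq_bigr => k _; rewrite regular_traceC.
Qed.

Lemma trace_representation (phi : {scalar E}) :
  exists a, forall y, phi y = T (y * a).
Proof.
have [e' dual_e] := dual_vbasis; set e := fun k : 'I__ => _ in dual_e.
exists (\sum_l phi (e l) *: e' l) => y.
rewrite {1}(dual_e y) mulr_sumr !linear_sum /=.
by apply: eq_bigr => l _; rewrite -scalerAr !linearZ /= mulrC.
Qed.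

End TraceForm.

(** * Positive involutions and orthogonal bases *)

Section PositiveInvolution.

Variables (E : falgType rat) (star : {linear E -> E}).
Hypothesis posE : positive_involution star.
Local Notation T := (@regular_trace E).

Let starM x y : star (x * y) = star y * star x. Proof. by case: posE. Qed.
Let starK : involutive star. Proof. by case: posE. Qed.

Lemma trace_star_gt0 x : x != 0 -> 0 < T (x * star x).
Proof. by case: posE => _ _; apply. Qed.

Lemma positive_trace_nondegenerate : trace_nondegenerate E.
Proof.
move=> x Tx0; apply/eqP; apply: contraT => /trace_star_gt0.
by rewrite Tx0 ltxx.
Qed.
Local Notation ndT := positive_trace_nondegenerate.

(* T (star x) is computed with the dual bases transported by star, using that the
   Casimir element of any pair of dual bases multiplies to 1. *)
Lemma regular_trace_star x : T (star x) = T x.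
Proof.
have [e' dual_e] := dual_vbasis ndT; set e := fun k : 'I__ => _ in dual_e.
have f'P k : exists f', forall y, T (star y * e' k) = T (y * f').
  pose phi y := T (star y * e' k).
  have phi_lin : scalar phi.
    by move=> a y z; rewrite /phi linearP mulrDl -scalerAl linearP.
  pose phi' : {scalar E} :=
    HB.pack phi (GRing.isLinear.Build rat E rat^o *%R phi phi_lin).
  exact: (trace_representation ndT phi').
have [f' {}f'P] := boolp.choice f'P.
have dual_f : dual_bases (star \o e) f'.
  move=> y; rewrite -{1}[y]starK {1}(dual_e (star y)) linear_sum.
  by apply: eq_bigr => k _; rewrite linearZ /= f'P.
rewrite -[star x]mulr1 -(casimir_unit ndT dual_f) mulr_sumr linear_sum /=.
transitivity (T ((\sum_k e' k * e k) * x)); last first.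
  by rewrite (casimir_unit ndT (dual_basesC ndT dual_e)) mul1r.
rewrite mulr_suml linear_sum; apply: eq_bigr => k _ /=.
by rewrite mulrA -f'P starM !starK regular_traceC mulrA.
Qed.

(** Gram-Schmidt for the positive form [T (x * star y)]. The rationals lack square roots, so the
    vectors are not normalized and their norms stay as denominators. *)
Lemma orthogonal_bases_in m (U : {vspace E}) : \dim U = m ->
  exists e : 'I_m -> E, (forall k, (e k != 0) && (e k \in U)) /\
   forall x, x \in U ->
     x = \sum_k (T (x * star (e k)) / T (e k * star (e k))) *: e k.
Proof.
elim: m U => [|m IHm] U dimU.
  exists (fun _ => 0); split=> [[]//|x].
  move/eqP: dimU; rewrite dimv_eq0 => /eqP ->.
  by rewrite memv0 big_ord0 => /eqP.
pose u := vpick U; have u_neq0 : u != 0.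
  by rewrite vpick0 -dimv_eq0 dimU.
have Uu : u \in U by apply: memv_pick.
pose phi (y : E) : rat^o := T (y * star u); have phi_lin : linear phi.
  by move=> a y z; rewrite /phi mulrDl -scalerAl linearP.
pose phi' : {linear E -> rat^o} :=
  HB.pack phi (GRing.isLinear.Build rat E rat^o *:%R phi phi_lin).
pose f := linfun phi'.
have fE y : f y = phi y by rewrite lfunE.
have fu : f u != 0 by rewrite fE gt_eqF // trace_star_gt0.
(* The orthogonal complement of [u] in [U] has codimension one, since [f] is a rational-valued
   functional that does not vanish at [u]. *)
have dimK : \dim (U :&: lker f) = m.
  apply/eqP; have := limg_ker_dim f U; rewrite dimU.
  suff -> : \dim (f @: U) = 1%N by rewrite addn1 => /eqP.
  apply/eqP; rewrite eqn_leq; apply/andP; split.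
    by rewrite (leq_trans (dimvS (subvf _))) ?dimvf.
  rewrite lt0n dimv_eq0; apply: contra fu => /eqP fU0.
  by rewrite -memv0 -fU0 memv_img.
have [e [eP eE]] := IHm _ dimK.
have orth k : T (u * star (e k)) = 0.
  have /andP[_] := eP k; rewrite memv_cap memv_ker fE => /andP[_ /eqP <-].
  by rewrite -regular_trace_star starM starK.
exists (fun k => if unlift ord0 k is Some j then e j else u); split=> [k|x Ux].
  case: unliftP => [j|] _; last by rewrite u_neq0.
  by have := eP j; rewrite memv_cap => /and3P[-> ->].
rewrite big_ord_recl unlift_none; set c := (_ / _).
under eq_bigr do rewrite liftK.
have Ky : x - c *: u \in (U :&: lker f)%VS.
  rewrite memv_cap memvB ?memvZ // memv_ker linearB linearZ /= !fE /phi.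
  by rewrite /c /GRing.scale /= divfK ?subrr // -/(phi u) -fE.
rewrite -{1}[x](subrK (c *: u)) addrC {1}(eE _ Ky); congr (_ + _).
apply: eq_bigr => k _; congr (_ / _ *: _).
by rewrite mulrBl linearB -scalerAl linearZ /= orth mulr0 subr0.
Qed.

(** The dual vectors are positive multiples of the [star (e k)]; this shape later makes an averaged
    hermitian form positive. *)
Lemma orthogonal_dual_bases : exists e : 'I_(\dim {:E}) -> E,
  exists d : 'I_(\dim {:E}) -> rat,
  (forall k, 0 < d k) /\ dual_bases e (fun k => d k *: star (e k)).
Proof.
have [e [eP eE]] := orthogonal_bases_in (erefl (\dim {:E})).
exists e, (fun k => (T (e k * star (e k)))^-1); split=> [k|x].
  by rewrite invr_gt0 trace_star_gt0 //; case/andP: (eP k).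
rewrite {1}(eE x (memvf _)); apply: eq_bigr => k _.
by rewrite -scalerAr linearZ /= mulrC.
Qed.

End PositiveInvolution.

(** * Averaging and traces of representations *)

Lemma mulmx_base_idem (F : fieldType) n (A : 'M[F]_n) :
  A *m A = A -> row_base A *m col_base A = 1%:M.
Proof.
move=> AA; apply: (row_full_inj (col_base_full A)).
apply: (row_free_inj (row_base_free A)).
by rewrite mulmx1 [X in X *m _]mulmxA mulmx_base -mulmxA mulmx_base AA.
Qed.

Lemma mxtrace_idem (F : fieldType) n (A : 'M[F]_n) :
  A *m A = A -> \tr A = (\rank A)%:R.
Proof.
move=> AA.
by rewrite -{1}(mulmx_base A) mxtrace_mulC mulmx_base_idem // mxtrace1.
Qed.

Lemma mxtrace_lin_mx (F : comNzRingType) m n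
    (f : {linear 'M[F]_(m, n) -> 'M[F]_(m, n)}) :
  \tr (lin_mx f) = \sum_i \sum_j f (delta_mx i j) i j.
Proof.
rewrite /mxtrace pair_big /=.
rewrite (reindex (uncurry (@mxvec_index m n))) /=; last first.
  exact: curry_mxvec_bij.
apply: eq_bigr => -[i j] _ /=.
have := mul_vec_lin f (delta_mx i j); rewrite mxvec_delta -rowE.
by move/(congr1 (fun A : 'rV_(m * n) => A 0 (mxvec_index i j)));
   rewrite mxE mxvecE.
Qed.

(** Clearing the denominator of [q] reduces the claim to integer multiples, where additivity
    suffices. *)
Lemma raddfZ_rat (F : numFieldType) (A : lmodType rat) (B : lmodType F)
    (f : {additive A -> B}) q x : f (q *: x) = ratr q *: f x.
Proof.
have fZz (m : int) y : f (m%:~R *: y) = m%:~R *: f y.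
  by rewrite !scaler_int raddfMz.
have d0 : (denq q)%:~R != 0 :> F by rewrite intr_eq0 denq_neq0.
apply: (scalerI d0); rewrite -fZz !scalerA /ratr mulrCA divff // mulr1.
by rewrite mulrC -numqE fZz.
Qed.

Section MakeRep.

Variables (R : realType) (E : falgType rat) (m : nat) (f : E -> 'M[R[i]]_m).

(** The two proofs are arguments so that the ring morphism structure can be attached to this name
    for an arbitrary [f]. *)
Definition rep_fun of zmod_morphism f & monoid_morphism f := f.

Variables (fB : zmod_morphism f) (fM : monoid_morphism f).

HB.instance Definition _ :=
  GRing.isZmodMorphism.Build E 'M[R[i]]_m (rep_fun fB fM) fB.
HB.instance Definition _ :=
  GRing.isMonoidMorphism.Build E 'M[R[i]]_m (rep_fun fB fM) fM.

Definition make_rep : crep R E := CRep (rep_fun fB fM).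

End MakeRep.

Section Representations.

Variables (R : realType) (E : falgType rat).
Implicit Types V W S : crep R E.

Lemma repZ V q x : V (q *: x) = ratr q *: V x.
Proof. exact: raddfZ_rat. Qed.

Lemma repM V x y : V (x * y) = V x *m V y.
Proof. exact: rmorphM. Qed.

(** Matrices act on columns, so [P] goes from [V] to [W]; the first matrix in [rep_iso V W] goes
    from [W] to [V]. *)
Definition rep_hom V W (P : 'M[R[i]]_(rdim W, rdim V)) :=
  forall x, P *m V x = W x *m P.

Definition chi V (x : E) : R[i] := \tr (V x).

Lemma chi1 V : chi V 1 = (rdim V)%:R.
Proof. by rewrite /chi rmorph1 mxtrace1. Qed.

Lemma eq_rdim V W : chi V =1 chi W -> rdim V = rdim W.
Proof.
by move/(_ 1); rewrite !chi1 => /eqP; rewrite eqr_nat => /eqP.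
Qed.

Lemma chiZ V q x : chi V (q *: x) = ratr q * chi V x.
Proof. by rewrite /chi repZ mxtraceZ. Qed.

Lemma chi_sum V I (r : seq I) (P : pred I) (F : I -> E) :
  chi V (\sum_(i <- r | P i) F i) = \sum_(i <- r | P i) chi V (F i).
Proof. by rewrite /chi rmorph_sum raddf_sum. Qed.

Lemma rep_hom1 V : rep_hom (V := V) (W := V) 1%:M.
Proof. by move=> x; rewrite mulmx1 mul1mx. Qed.

Lemma rep_homM U V W (P : 'M_(rdim W, rdim V)) (Q : 'M_(rdim V, rdim U)) :
  rep_hom P -> rep_hom Q -> rep_hom (P *m Q).
Proof. by move=> hP hQ x; rewrite -mulmxA hQ mulmxA hP mulmxA. Qed.

Lemma rep_homB V W (P Q : 'M_(rdim W, rdim V)) :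
  rep_hom P -> rep_hom Q -> rep_hom (P - Q).
Proof. by move=> hP hQ x; rewrite mulmxBl mulmxBr hP hQ. Qed.

Lemma rep_hom_scalar V c : rep_hom (V := V) (W := V) c%:M.
Proof. by move=> x; rewrite scalar_mxC. Qed.

Lemma chi_iso V W : rep_iso V W -> chi V =1 chi W.
Proof.
case=> P [Q [PQ QP hP]] x; rewrite /chi.
by rewrite -[V x]mulmx1 -PQ mulmxA hP mxtrace_mulC mulmxA QP mul1mx.
Qed.

(** The image of [Q] as a representation: the rank factorization of an idempotent is an inclusion
    [i] followed by a retraction [p], and the action is compressed to [p *m V x *m i]. *)
Lemma idem_split V (Q : 'M_(rdim V)) : rep_hom Q -> Q *m Q = Q ->
  exists W (i : 'M_(rdim V, rdim W)) (p : 'M_(rdim W, rdim V)),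
    [/\ rep_hom i, rep_hom p, p *m i = 1%:M & i *m p = Q].
Proof.
move=> hQ QQ; have := mulmx_base_idem QQ; have := mulmx_base Q.
move: (\rank Q) (col_base Q) (row_base Q) => r i p ip pi.
pose f x := p *m V x *m i.
have fB : zmod_morphism f by move=> x y; rewrite /f rmorphB mulmxBr mulmxBl.
have fM : monoid_morphism f.
  split=> [|x y]; first by rewrite /f rmorph1 mulmx1 pi.
  rewrite /f repM -!mulmxE -!mulmxA; congr (_ *m _).
  rewrite (mulmxA i) ip (mulmxA Q) hQ -mulmxA.
  by rewrite -ip -(mulmxA i) pi mulmx1.
exists (make_rep fB fM), i, p; split=> // x; rewrite /= /rep_fun /f.
  by rewrite !mulmxA ip hQ -ip -!mulmxA pi mulmx1.
by rewrite -[RHS]mulmxA ip -mulmxA -hQ -ip !mulmxA pi mul1mx.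
Qed.

Lemma chi_split V W (i : 'M_(rdim V, rdim W)) (p : 'M_(rdim W, rdim V)) :
  rep_hom i -> p *m i = 1%:M -> forall x, chi W x = \tr (i *m p *m V x).
Proof.
move=> hi pi x; rewrite /chi -[W x]mul1mx -pi -mulmxA hi.
by rewrite mulmxA mxtrace_mulC mulmxA.
Qed.

(** Irreducibility is taken in the form of Schur's lemma, ready for trace computations; [simple_irr]
    and [irr_simple] relate it to invariant subspaces. *)
Definition irr V :=
  (0 < rdim V)%N /\ forall P : 'M_(rdim V), rep_hom P -> exists c, P = c%:M.

Section Averaging.

Variables (n : nat) (e e' : 'I_n -> E).
Hypotheses (ndT : trace_nondegenerate E) (dual_e : dual_bases e e').

Definition avg V W (P : 'M_(rdim W, rdim V)) := \sum_k W (e k) *m P *m V (e' k).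

Fact avg_is_linear V W : linear (@avg V W).
Proof.
move=> a P Q; rewrite /avg scaler_sumr -big_split /=; apply: eq_bigr => k _.
by rewrite mulmxDr mulmxDl -scalemxAr -scalemxAl.
Qed.

HB.instance Definition _ V W := GRing.isLinear.Build R[i]
  'M[R[i]]_(rdim W, rdim V) 'M[R[i]]_(rdim W, rdim V) *:%R (@avg V W)
  (@avg_is_linear V W).

Lemma rep_hom_avg V W (P : 'M_(rdim W, rdim V)) : rep_hom (avg P).
Proof.
move=> x; rewrite /avg mulmx_suml mulmx_sumr.
pose b y z := W y *m P *m V z.
transitivity (\sum_k b (e k) (e' k * x)).
  by apply: eq_bigr => k _; rewrite /b rmorphM -!mulmxA.
rewrite -(@casimirM E ndT _ b) //.
- by apply: eq_bigr => k _; rewrite /b rmorphM -!mulmxA.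
- by move=> y u v; rewrite /b rmorphB !mulmxBl.
- by move=> y u v; rewrite /b rmorphB !mulmxBr.
by move=> q y z; rewrite /b !repZ -!scalemxAl -scalemxAr.
Qed.

Lemma avg_hom V W (P : 'M_(rdim W, rdim V)) : rep_hom P -> avg P = P.
Proof.
move=> hP; rewrite /avg; under eq_bigr => k _ do
  rewrite -hP -mulmxA -repM.
by rewrite -mulmx_sumr -rmorph_sum (casimir_unit ndT dual_e) rmorph1 mulmx1.
Qed.

Lemma avg_mull U V W (A : 'M_(rdim W, rdim V)) (P : 'M_(rdim V, rdim U)) :
  rep_hom A -> A *m avg P = avg (A *m P).
Proof.
move=> hA; rewrite mulmx_sumr; apply: eq_bigr => k _.
by rewrite !mulmxA hA.
Qed.

Lemma avg_mulr U V W (P : 'M_(rdim W, rdim V)) (A : 'M_(rdim V, rdim U)) :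
  rep_hom A -> avg P *m A = avg (P *m A).
Proof.
move=> hA; rewrite mulmx_suml; apply: eq_bigr => k _.
by rewrite -mulmxA -hA !mulmxA.
Qed.

Lemma mxtrace_avg V (P : 'M_(rdim V)) : \tr (avg P) = \tr P.
Proof.
rewrite raddf_sum /=; under eq_bigr => k _ do
  rewrite mxtrace_mulC mulmxA mxtrace_mulC -repM.
rewrite -raddf_sum -mulmx_sumr -rmorph_sum.
by rewrite (casimir_unit ndT (dual_basesC ndT dual_e)) rmorph1 mulmx1.
Qed.

(** The averaging projection as a matrix on vectorized matrices; its row space is the space of
    intertwiners from [V] to [W]. *)
Definition hom_space V W := lin_mx (@avg V W).

Lemma hom_spaceP V W (P : 'M_(rdim W, rdim V)) :
  rep_hom P <-> mxvec P *m hom_space V W = mxvec P.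
Proof.
rewrite mul_vec_lin; split=> [hP|]; first by rewrite /= avg_hom.
by move/(can_inj mxvecK) => <-; apply: rep_hom_avg.
Qed.

Lemma hom_space_idem V W :
  hom_space V W *m hom_space V W = hom_space V W.
Proof.
apply/row_matrixP => i; rewrite !rowE mulmxA.
rewrite -[delta_mx 0 i]vec_mxK !mul_vec_lin /= avg_hom //; exact: rep_hom_avg.
Qed.

Definition ip W V := \sum_k chi W (e k) * chi V (e' k).

Lemma ip_delta W V : ip W V = \sum_i \sum_j @avg V W (delta_mx i j) i j.
Proof.
under [RHS]eq_bigr => i _ do under eq_bigr => j _ do rewrite /avg summxE.
under [RHS]eq_bigr do rewrite exchange_big /=.
rewrite exchange_big; apply: eq_bigr => k _ /=.
rewrite /chi /mxtrace mulr_suml; apply: eq_bigr => i _.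
rewrite mulr_sumr; apply: eq_bigr => j _.
rewrite mxE (bigD1 j) //= mxE (bigD1 i) //= mxE !eqxx mulr1.
rewrite big1 ?addr0 => [|l li]; last by rewrite mxE (negPf li) mulr0.
rewrite big1 ?addr0 // => l lj; rewrite mxE big1 ?mul0r // => l' _.
by rewrite mxE (negPf lj) andbF mulr0.
Qed.

(** Computed on elementary matrices, the trace of the averaging map is the pairing of the two
    characters; the map being idempotent, its trace is its rank. *)
Lemma dim_hom_space W V : ip W V = (\rank (hom_space V W))%:R.
Proof. by rewrite -mxtrace_idem ?hom_space_idem // mxtrace_lin_mx ip_delta. Qed.

Lemma ip_neq0P W V : ip W V != 0 <->
  exists2 P : 'M_(rdim W, rdim V), rep_hom P & P != 0.
Proof.
rewrite dim_hom_space pnatr_eq0 mxrank_eq0; split.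
  case/rowV0Pn=> u /submxP[v ->] vQ; exists (vec_mx (v *m hom_space V W)).
    by apply/hom_spaceP; rewrite vec_mxK -mulmxA hom_space_idem.
  by apply: contra vQ => /eqP vQ0; rewrite -[_ *m _]vec_mxK vQ0 linear0.
case=> P /hom_spaceP hP; apply: contraNneq => Q0.
by move: hP; rewrite Q0 mulmx0 => /esym/eqP; rewrite mxvec_eq0.
Qed.

(** Complete reducibility in matrix form: averaging a linear pseudo-inverse of [P] keeps the
    identity [P *m G *m P = P]. *)
Lemma hom_qinv V W (P : 'M_(rdim W, rdim V)) : rep_hom P ->
  exists2 G : 'M_(rdim V, rdim W), rep_hom G & P *m G *m P = P.
Proof.
move=> hP; exists (avg (pinvmx P)); first exact: rep_hom_avg.
by rewrite (avg_mull _ hP) (avg_mulr _ hP) mulmxKpV // avg_hom.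
Qed.

Lemma idem_complement V (Q : 'M_(rdim V)) : rep_hom Q -> Q *m Q = Q ->
  exists W (i : 'M_(rdim V, rdim W)) (p : 'M_(rdim W, rdim V)),
  [/\ rep_hom i, rep_hom p, p *m i = 1%:M, i *m p = 1%:M - Q
    & forall x, chi W x = chi V x - \tr (Q *m V x)].
Proof.
move=> hQ QQ; have [||W [i [p [hi hp pi ip]]]] := @idem_split V (1%:M - Q).
- exact: rep_homB (rep_hom1 V) hQ.
- by rewrite mulmxBl mul1mx mulmxBr mulmx1 QQ subrr subr0.
exists W, i, p; split=> // x.
by rewrite (chi_split hi pi) ip mulmxBl mul1mx raddfB.
Qed.

(* Equal traces give a nonzero intertwiner; it splits off isomorphic summands. *)
Lemma iso_chi V W : chi V =1 chi W -> rep_iso V W.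
Proof.
have [m] : exists m, (rdim V <= m)%N by exists (rdim V).
elim: m V W => [|m IHm] V W.
  rewrite leqn0 => /eqP V0 eqVW; have W0 := eq_rdim eqVW; rewrite V0 in W0.
  exists 0, 0; split; first by apply/matrixP => k; have := ltn_ord k; rewrite {2}V0.
    by apply/matrixP => k; have := ltn_ord k; rewrite -[X in (_ < X)%N]W0.
  by move=> x; rewrite mulmx0 mul0mx.
move=> leVm eqVW; have [V0|V_gt0] := posnP (rdim V).
  by apply: IHm; rewrite // V0.
have ipVW : ip W V != 0.
  rewrite /ip; under eq_bigr do rewrite -eqVW; rewrite -/(ip V V).
  apply/ip_neq0P; exists 1%:M; first exact: rep_hom1.
  by rewrite -mxrank_eq0 mxrank1 -lt0n.
have /ip_neq0P[P hP P_neq0] := ipVW.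
have [G hG PGP] := hom_qinv hP.
(* This change makes the quasi-inverse reflexive, so that [f *m P] and [P *m f] are idempotents with
   isomorphic images. *)
pose f := G *m P *m G.
have hf : rep_hom f by rewrite /f -mulmxA; do 2?apply: rep_homM.
have PfP : P *m f *m P = P by rewrite /f !mulmxA !PGP.
have GPGP : G *m P *m G *m P = G *m P by rewrite -!mulmxA (mulmxA P) PGP.
have fPf : f *m P *m f = f by rewrite /f !mulmxA !GPGP.
clearbody f.
have idV : f *m P *m (f *m P) = f *m P by rewrite mulmxA fPf.
have idW : P *m f *m (P *m f) = P *m f by rewrite mulmxA PfP.
have [V' [iV [pV [hiV hpV piV ipV chiV]]]] :=
  idem_complement (rep_homM hf hP) idV.
have [W' [iW [pW [hiW hpW piW ipW chiW]]]] :=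
  idem_complement (rep_homM hP hf) idW.
have eqV'W' : chi V' =1 chi W'.
  move=> x; rewrite chiV chiW eqVW; congr (_ - _).
  by rewrite -!mulmxA hP mulmxA mxtrace_mulC.
have ltV' : (rdim V' <= m)%N.
  rewrite -ltnS (leq_trans _ leVm) //.
  have fP0 : f *m P != 0.
    by apply: contraNneq P_neq0 => fP0; rewrite -PfP -mulmxA fP0 mulmx0.
  have := chiV 1; rewrite !chi1 rmorph1 mulmx1 mxtrace_idem //.
  move/eqP; rewrite eq_sym subr_eq -natrD eqr_nat => /eqP ->.
  by rewrite -addn1 leq_add2l lt0n mxrank_eq0.
have [A [B [AB BA hA]]] := IHm _ _ ltV' eqV'W'.
have hB : rep_hom (V := V') (W := W') B.
  by move=> x; rewrite -[W' x]mul1mx -BA -(mulmxA B) -hA !mulmxA -mulmxA AB mulmx1.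
have fiW : f *m iW = 0.
  by rewrite -fPf -!mulmxA (mulmxA P) -(subKr 1%:M (P *m f)) -ipW mulmxBl mul1mx
    -mulmxA piW mulmx1 subrr mulmx0.
have pWP : pW *m P = 0.
  by rewrite -PfP mulmxA -(subKr 1%:M (P *m f)) -ipW mulmxBr mulmx1 mulmxA piW
    mul1mx subrr mul0mx.
have PiV : P *m iV = 0.
  by rewrite -PfP -!mulmxA (mulmxA f) -(subKr 1%:M (f *m P)) -ipV mulmxBl mul1mx
    -mulmxA piV mulmx1 subrr mulmx0.
have pVf : pV *m f = 0.
  by rewrite -fPf mulmxA -(subKr 1%:M (f *m P)) -ipV mulmxBr mulmx1 mulmxA piV
    mul1mx subrr mul0mx.
(* On the images of the idempotents the isomorphism is [f] and [P], on the complements it comes from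
   the induction; the four vanishing products remove the cross terms. *)
exists (f + iV *m A *m pW), (P + iW *m B *m pV); split.
- rewrite mulmxDl !mulmxDr !mulmxA fiW !mul0mx addr0 -[_ *m pW *m P]mulmxA pWP.
  rewrite mulmx0 add0r -[_ *m pW *m iW]mulmxA piW mulmx1 -[_ *m A *m B]mulmxA AB.
  by rewrite mulmx1 ipV addrC subrK.
- rewrite mulmxDl !mulmxDr !mulmxA PiV !mul0mx addr0 -[_ *m pV *m f]mulmxA pVf.
  rewrite mulmx0 add0r -[_ *m pV *m iV]mulmxA piV mulmx1 -[_ *m B *m A]mulmxA BA.
  by rewrite mulmx1 ipW addrC subrK.
move=> x; rewrite mulmxDl mulmxDr -hf -!mulmxA hpW.
by congr (_ + _); rewrite !mulmxA -hiV -!(mulmxA iV) -hA !mulmxA.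
Qed.

(** Over the complex numbers a non-scalar intertwiner [P] has an eigenvalue [c]; the image of
    [P - c%:M] is then a proper nonzero direct summand, and the dimension drops. *)
Lemma irr_split V : (0 < rdim V)%N ->
  exists S (i : 'M_(rdim V, rdim S)) (p : 'M_(rdim S, rdim V)),
    [/\ irr S, rep_hom i, rep_hom p & p *m i = 1%:M].
Proof.
have [m] : exists m, (rdim V <= m)%N by exists (rdim V).
elim: m V => [|m IHm] V.
  by move=> le0 /leq_trans /(_ le0).
move=> leVm V_gt0; have [irrV|] := boolp.pselect (irr V).
  by exists V, 1%:M, 1%:M; split; rewrite ?mulmx1 //; exact: rep_hom1.
move=> nirrV; have {nirrV} [P hP nP] : exists2 P : 'M_(rdim V), rep_hom P &
    forall c, P != c%:M.
  apply: boolp.contrapT => noP; apply: nirrV; split=> // P hP.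
  apply: boolp.contrapT => nP; apply: noP; exists P => // c.
  by apply/eqP => Pc; apply: nP; exists c.
have [c /eigenvalueP[v vP v_neq0]] : exists c, eigenvalue P c.
  have : size (char_poly P) != 1%N by rewrite size_char_poly eqSS -lt0n.
  by case/closed_rootP=> c; rewrite -eigenvalue_root_char; exists c.
pose Q := P - c%:M.
have hQ : rep_hom Q by apply: rep_homB hP _; apply: rep_hom_scalar.
have vQ : v *m Q = 0 by rewrite mulmxBr vP mul_mx_scalar subrr.
have [G hG QGQ] := hom_qinv hQ.
have idQ : Q *m G *m (Q *m G) = Q *m G by rewrite mulmxA QGQ.
have [V' [i [p [hi hp pi ip]]]] := idem_split (rep_homM hQ hG) idQ.
have V'_gt0 : (0 < rdim V')%N.
  rewrite lt0n; apply/eqP => V'0; have := nP c; rewrite -subr_eq0 -/Q -QGQ -ip.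
  have -> : i = 0 by apply/matrixP => k l; have := ltn_ord l; rewrite {2}V'0.
  by rewrite !mul0mx eqxx.
have ltV' : (rdim V' <= m)%N.
  rewrite -ltnS (leq_trans _ leVm) // -(mxrank1 R[i] (rdim V')) -pi.
  apply: leq_ltn_trans (mxrankM_maxr _ _) _; rewrite ltn_neqAle rank_leq_row andbT.
  apply: contra v_neq0 => /eqP ri.
  have : row_free i by rewrite /row_free ri.
  move/row_free_inj => inj_i; apply/eqP/inj_i; rewrite mul0mx.
  by rewrite -(mulmx1 i) -pi !mulmxA -(mulmxA v) ip mulmxA vQ !mul0mx.
have [S [i1 [p1 [irrS hi1 hp1 pi1]]]] := IHm _ ltV' V'_gt0.
exists S, (i *m i1), (p1 *m p); split=> //; try exact: rep_homM.
by rewrite mulmxA -(mulmxA p1) pi mulmx1.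
Qed.

(** Splitting off one irreducible summand at a time. The decomposition is recorded on traces only,
    which suffices since traces determine representations. *)
Lemma rep_ind (K : crep R E -> Prop) :
  (forall V, rdim V = 0%N -> K V) ->
  (forall V S W, irr S -> (forall x, chi V x = chi S x + chi W x) -> K W -> K V) ->
  forall V, K V.
Proof.
move=> K0 KS V; have [m] : exists m, (rdim V <= m)%N by exists (rdim V).
elim: m V => [|m IHm] V; first by rewrite leqn0 => /eqP; apply: K0.
move=> leVm; have [|V_gt0] := posnP (rdim V); first exact: K0.
have [S [i [p [irrS hi hp pi]]]] := irr_split V_gt0.
have id_ip : i *m p *m (i *m p) = i *m p by rewrite mulmxA -(mulmxA i) pi mulmx1.
have [W [_ [_ [_ _ _ _ chiW]]]] := idem_complement (rep_homM hi hp) id_ip.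
have chiV x : chi V x = chi S x + chi W x.
  by rewrite chiW (chi_split hi pi) addrC subrK.
apply: (KS _ _ _ irrS chiV); apply: IHm; rewrite -ltnS (leq_trans _ leVm) //.
have := chiV 1; rewrite !chi1 -natrD => /eqP; rewrite eqr_nat => /eqP ->.
by rewrite -add1n leq_add2r; case: irrS.
Qed.

End Averaging.
End Representations.

Lemma mem_centerP (E : falgType rat) (u : E) :
  reflect (forall v, u * v = v * u) (u \in 'Z({:E})%VS).
Proof.
rewrite memv_cap memvf /=; apply: (iffP centvP) => [cu v|cu v _] //.
by rewrite cu ?memvf.
Qed.

Lemma vsval_center1 (E : falgType rat) : vsval (1 : algebra_center E) = 1.
Proof.
by apply/eqP; rewrite [_ == _]algid_eq1; apply/mem_centerP => v; rewrite mul1r mulr1.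
Qed.

Lemma mulmx_cV_eq0 (F : pzRingType) m n (A : 'M[F]_(m, n)) :
  (forall w : 'cV_n, A *m w = 0) -> A = 0.
Proof.
move=> A0; apply/matrixP => i j.
by have /colP/(_ i) := A0 (delta_mx j 0); rewrite -colE !mxE.
Qed.

(** * Irreducible representations and Schur's lemma *)

Section Irreducible.

Variables (R : realType) (E : falgType rat).
Variables (n : nat) (e e' : 'I_n -> E).
Hypotheses (ndT : trace_nondegenerate E) (dual_e : dual_bases e e').
Implicit Types V W S : crep R E.

Local Notation avg := (avg e e').
Local Notation ip := (ip e e').

Lemma rdim_neq0 V : irr V -> (rdim V)%:R != 0 :> R[i].
Proof. by case=> V_gt0 _; rewrite pnatr_eq0 -lt0n. Qed.

Lemma chi_scalar V z c : irr V -> V z = c%:M -> chi V z / (rdim V)%:R = c.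
Proof.
move=> irrV Vz; rewrite /chi Vz mxtrace_scalar -(mulr_natr c) mulfK //.
exact: rdim_neq0.
Qed.

(** For an eigenvalue [c] of an intertwiner [P], the image of [P - c%:M] is invariant and proper,
    hence zero. *)
Lemma simple_irr V : simple_rep V -> irr V.
Proof.
case=> V_gt0 simV; split=> // P hP.
have [c /eigenvalueP[v vP v_neq0]] : exists c, eigenvalue P c.
  have : size (char_poly P) != 1%N by rewrite size_char_poly eqSS -lt0n.
  by case/closed_rootP=> c; rewrite -eigenvalue_root_char; exists c.
exists c; apply/eqP; rewrite -subr_eq0; set Q := P - c%:M.
have hQ : rep_hom (V := V) (W := V) Q.
  by apply: rep_homB hP _; apply: rep_hom_scalar.
have vQ : v *m Q = 0 by rewrite mulmxBr vP mul_mx_scalar subrr.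
pose f : 'End('cV[R[i]]_(rdim V)) := linfun (mulmx Q).
have fE w : f w = Q *m w by rewrite lfunE.
case: (simV (limg f)) => [x w /memv_imgP[u _ ->]|imf0|imfT].
- by rewrite fE mulmxA -hQ -mulmxA -fE memv_img ?memvf.
- apply/eqP/mulmx_cV_eq0 => w; apply/eqP.
  by rewrite -memv0 -imf0 -fE memv_img ?memvf.
case/eqP: v_neq0; apply: mulmx_cV_eq0 => w.
have /memv_imgP[u _ ->] : w \in limg f by rewrite imfT memvf.
by rewrite fE mulmxA vQ mul0mx.
Qed.

(** Averaging a linear projector onto an invariant [U] gives a scalar that has image in [U] and is
    the identity on [U]. *)
Lemma irr_simple V : irr V -> simple_rep V.
Proof.
case=> V_gt0 irrV; split=> // U invU.
(* The transposes are there because [lin1_mx] acts on rows while representations act on columns. *)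
pose M := (lin1_mx (trmx \o projv U \o trmx))^T.
have ME v : M *m v = projv U v.
  by rewrite -[LHS]trmxK trmx_mul trmxK mul_rV_lin1 /= !trmxK.
have [c Ac] := irrV _ (rep_hom_avg ndT dual_e M).
have AU v : avg M *m v \in U.
  rewrite mulmx_suml memv_suml // => k _.
  by rewrite -!mulmxA; apply: invU; rewrite ME memv_proj.
have Aid v : v \in U -> avg M *m v = v.
  move=> Uv; rewrite mulmx_suml; under eq_bigr => k _ do
    rewrite -!mulmxA ME projv_id ?invU // mulmxA -repM.
  by rewrite -mulmx_suml -rmorph_sum (casimir_unit ndT dual_e) rmorph1 mul1mx.
have [->|U_neq0] := eqVneq U 0%VS; [by left | right].
have c1 : c = 1.
  have := Aid _ (memv_pick U); rewrite Ac mul_scalar_mx => /eqP.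
  rewrite -subr_eq0 -[X in _ - X]scale1r -scalerBl scaler_eq0 vpick0.
  by rewrite (negPf U_neq0) orbF subr_eq0 => /eqP.
apply/vspaceP => v; rewrite memvf; have := AU v.
by rewrite Ac c1 mul1mx.
Qed.

Lemma irr_avg V (P : 'M_(rdim V)) : irr V ->
  avg P = (\tr P / (rdim V)%:R)%:M.
Proof.
move=> irrV; have [_ scalV] := irrV.
have [c Ac] := scalV _ (rep_hom_avg ndT dual_e P).
have := mxtrace_avg ndT dual_e P; rewrite Ac mxtrace_scalar => <-.
by rewrite -(mulr_natr c) mulfK ?rdim_neq0.
Qed.

Lemma irr_ip V : irr V -> ip V V = 1.
Proof.
move=> irrV; rewrite ip_delta.
transitivity (\sum_(i < rdim V) (rdim V)%:R^-1 : R[i]).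
  apply: eq_bigr => i _; rewrite (bigD1 i) //= big1 ?addr0 => [|j ji].
    rewrite irr_avg // mxE eqxx mulr1n /mxtrace (bigD1 i) //= mxE !eqxx big1.
      by rewrite addr0 mul1r.
    by move=> j ji; rewrite mxE (negPf ji).
  by rewrite irr_avg // mxE eq_sym (negPf ji).
by rewrite sumr_const card_ord -(mulr_natr _^-1) mulVf ?rdim_neq0.
Qed.

(** For a quasi-inverse [G], both [G *m P] and [P *m G] are scalars, and [P *m G *m P = P] with [P]
    nonzero forces them to be 1. *)
Lemma irr_hom_chi V W (P : 'M_(rdim W, rdim V)) :
  irr V -> irr W -> rep_hom P -> P != 0 -> chi V =1 chi W.
Proof.
move=> [_ irrV] [_ irrW] hP P_neq0 x.
have [G hG PGP] := hom_qinv ndT dual_e hP.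
have [c GPc] := irrV _ (rep_homM hG hP); have [d PGd] := irrW _ (rep_homM hP hG).
have scal1 (k : R[i]) : k *: P = P -> k = 1.
  move/eqP; rewrite -subr_eq0 -[X in _ - X]scale1r -scalerBl scaler_eq0.
  by rewrite (negPf P_neq0) orbF subr_eq0 => /eqP.
have c1 : c = 1 by apply: scal1; rewrite -mul_mx_scalar -GPc mulmxA.
have d1 : d = 1 by apply: scal1; rewrite -mul_scalar_mx -PGd.
transitivity (\tr (G *m P *m V x)); first by rewrite GPc c1 mul1mx.
by rewrite -mulmxA hP mulmxA mxtrace_mulC mulmxA PGd d1 mul1mx.
Qed.

Lemma irr_ip_chi V W : irr V -> irr W -> ip W V != 0 -> chi V =1 chi W.
Proof.
move=> irrV irrW /(ip_neq0P ndT dual_e)[P hP P_neq0].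
exact: irr_hom_chi hP P_neq0.
Qed.

(** The projection of [E] onto its center that preserves all characters; it reduces questions about
    [chi] to the center. *)
Definition cproj x := \sum_k e k * x * e' k.

Lemma cprojP x : cproj x \in 'Z({:E})%VS.
Proof.
apply/mem_centerP => y; rewrite /cproj mulr_suml mulr_sumr.
have [bBl bBr bZ] := balanced_mul x.
under eq_bigr do rewrite -[_ * _ * _ * _]mulrA.
rewrite -(casimirM ndT bBl bBr bZ y dual_e).
by apply: eq_bigr => k _; rewrite !mulrA.
Qed.

Lemma cproj_id z : z \in 'Z({:E})%VS -> cproj z = z.
Proof.
move/mem_centerP => cz; rewrite /cproj; under eq_bigr do rewrite -cz -mulrA.
by rewrite -mulr_sumr (casimir_unit ndT dual_e) mulr1.
Qed.

Lemma cproj_linear : linear cproj.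
Proof.
move=> a x y; rewrite /cproj scaler_sumr -big_split; apply: eq_bigr => k _ /=.
by rewrite mulrDr mulrDl -scalerAr -scalerAl.
Qed.

Lemma cproj_centerM z x : z \in 'Z({:E})%VS -> cproj (z * x) = z * cproj x.
Proof.
move/mem_centerP => cz; rewrite /cproj mulr_sumr; apply: eq_bigr => k _.
by rewrite !mulrA cz.
Qed.

Lemma irr_center V z : irr V -> z \in 'Z({:E})%VS ->
  V z = (chi V z / (rdim V)%:R)%:M.
Proof.
move=> irrV /mem_centerP cz; have [_ scalV] := irrV.
have [|c Vc] := scalV (V z); first by move=> x; rewrite -!repM cz.
by rewrite /chi Vc mxtrace_scalar -(mulr_natr c) mulfK ?rdim_neq0.
Qed.

Lemma chi_cproj V x : chi V (cproj x) = chi V x.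
Proof.
rewrite /cproj chi_sum -[in RHS](mulr1 x).
rewrite -(casimir_unit ndT (dual_basesC ndT dual_e)) mulr_sumr chi_sum.
by apply: eq_bigr => k _; rewrite /chi !repM mxtrace_mulC !mulmxA mxtrace_mulC mulmxA.
Qed.

(** Through [cproj] the two characters are proportional on all of [E], so [ip W V] is a nonzero
    multiple of [ip V V = 1]. *)
Lemma irr_center_inj V W : irr V -> irr W ->
  (forall z, z \in 'Z({:E})%VS ->
    chi V z / (rdim V)%:R = chi W z / (rdim W)%:R) -> chi V =1 chi W.
Proof.
move=> irrV irrW eqVW; apply: irr_ip_chi => //.
have eqW x : chi W x = (rdim W)%:R / (rdim V)%:R * chi V x.
  rewrite -[chi W x]chi_cproj -[chi V x]chi_cproj.
  rewrite mulrAC -mulrA eqVW ?cprojP // mulrC divfK ?rdim_neq0 //.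
have -> : ip W V = (rdim W)%:R / (rdim V)%:R * ip V V.
  by rewrite mulr_sumr; apply: eq_bigr => k _; rewrite eqW !mulrA.
rewrite irr_ip // mulr1.
by rewrite mulf_neq0 ?invr_eq0 ?rdim_neq0.
Qed.

Lemma central_character V : irr V ->
  exists sigma : {rmorphism algebra_center E -> R[i]},
    forall z, V (vsval z) = (sigma z)%:M.
Proof.
move=> irrV; pose f (z : algebra_center E) := chi V (vsval z) / (rdim V)%:R.
have fP z : V (vsval z) = (f z)%:M by apply: irr_center => //; apply: subvsP.
have scalI : injective (fun c : R[i] => c%:M : 'M_(rdim V)).
  move=> a b /(congr1 (@mxtrace _ _)); rewrite !mxtrace_scalar.
  by rewrite -(mulr_natr a) -(mulr_natr b) => /(mulIf (rdim_neq0 irrV)).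
have fB : zmod_morphism f.
  move=> x y; apply: scalI; rewrite -fP linearB rmorphB !fP.
  by rewrite -raddfB.
have fM : monoid_morphism f.
  split=> [|x y]; apply: scalI; rewrite -fP.
    by rewrite vsval_center1 rmorph1.
  by rewrite repM !fP -scalar_mxM.
pose g : {rmorphism algebra_center E -> R[i]} :=
  HB.pack f (GRing.isZmodMorphism.Build _ _ f fB)
            (GRing.isMonoidMorphism.Build _ _ f fM).
by exists g.
Qed.

End Irreducible.

(** * Central characters *)

Section Regular.

Variables (R : realType) (E : falgType rat).

Definition left_mul_mx (x : E) : 'M[rat]_(\dim {:E}) :=
  \matrix_(i, j) coord (vbasis {:E}) i (x * (vbasis {:E})`_j).

Definition regular_fun (x : E) : 'M[R[i]]_(\dim {:E}) :=
  map_mx ratr (left_mul_mx x).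

Fact regular_funB : zmod_morphism regular_fun.
Proof.
move=> x y; rewrite /regular_fun -map_mxB; congr map_mx.
by apply/matrixP => i j; rewrite !mxE mulrBl linearB.
Qed.

Fact regular_funM : monoid_morphism regular_fun.
Proof.
split=> [|x y]; rewrite /regular_fun.
  rewrite -[RHS](map_mx1 ratr); congr map_mx; apply/matrixP => i j.
  by rewrite !mxE mul1r (coord_free _ _ (basis_free (vbasisP _))) eq_sym.
rewrite -mulmxE -map_mxM; congr map_mx; apply/matrixP => i j; rewrite !mxE.
rewrite -mulrA {1}(coord_fullv (y * _)) mulr_sumr linear_sum /=.
by apply: eq_bigr => k _; rewrite -scalerAr linearZ /= !mxE mulrC.
Qed.

Definition regular_rep : crep R E := make_rep regular_funB regular_funM.

Lemma chi_regular x : chi regular_rep x = ratr (regular_trace x).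
Proof.
rewrite /chi /mxtrace /= /rep_fun /regular_trace rmorph_sum.
by apply: eq_bigr => i _; rewrite !mxE.
Qed.

End Regular.

Section CenterBasis.

Variable E : falgType rat.

Definition center_basis (k : 'I_(\dim 'Z({:E}))) : algebra_center E :=
  vsproj _ (vbasis 'Z({:E}))`_k.

Lemma center_basisE k : vsval (center_basis k) = (vbasis 'Z({:E}))`_k.
Proof. by rewrite vsprojK // vbasis_mem // mem_nth // size_tuple. Qed.

Lemma center_coord (z : algebra_center E) :
  z = \sum_k coord (vbasis 'Z({:E})%VS) k (vsval z) *: center_basis k.
Proof.
apply: subvs_inj; rewrite linear_sum {1}(coord_vbasis (subvsP z)).
by apply: eq_bigr => k _; rewrite linearZ /= center_basisE.
Qed.

End CenterBasis.

(** * Simple representations and the embeddings of the center *)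

Section CompleteFamily.

Variables (R : realType) (E : falgType rat).
Variables (n : nat) (e e' : 'I_n -> E).
Hypotheses (ndT : trace_nondegenerate E) (dual_e : dual_bases e e').
Implicit Types V U : crep R E.

Local Notation ip := (ip e e').
Local Notation cproj := (cproj e e').
Local Notation T := (@regular_trace E).
Local Notation Z := (algebra_center E).

Definition complete_family s (W : 'I_s -> crep R E) :=
  [/\ forall i, irr (W i),
      forall i j, chi (W i) =1 chi (W j) -> i = j
    & forall V, irr V -> exists i, chi V =1 chi (W i)].

Lemma ip_suml I (r : seq I) (a : I -> R[i]) (F : I -> crep R E) V U :
    (forall x, chi V x = \sum_(i <- r) a i * chi (F i) x) ->
  ip V U = \sum_(i <- r) a i * ip (F i) U.
Proof.
move=> chiV; rewrite /ip; under eq_bigr do rewrite chiV mulr_suml.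
rewrite exchange_big /=; apply: eq_bigr => i _; rewrite mulr_sumr.
by apply: eq_bigr => k _; rewrite mulrA.
Qed.

(** The character of the regular representation is [T], so the pairing is [chi V] applied to the
    dual expansion of 1. *)
Lemma ip_regular V : ip (regular_rep R E) V = (rdim V)%:R.
Proof.
rewrite -chi1 [in RHS](dual_bases_sym ndT dual_e 1) chi_sum.
by apply: eq_bigr => k _; rewrite chi_regular chiZ mulr1.
Qed.

(** Every irreducible [V] pairs to its nonzero dimension with the regular representation, hence
    occurs among the constituents of the latter; it remains to discard repetitions. *)
Lemma ex_complete_family : exists s (W : 'I_s -> crep R E), complete_family W.
Proof.
have [r [F [irrF chiF]]] : exists r (F : 'I_r -> crep R E),
    (forall i, irr (F i)) /\
    (forall x, chi (regular_rep R E) x = \sum_i 1 * chi (F i) x).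
  move: (regular_rep R E) => V.
  elim/(@rep_ind R E n e e' ndT dual_e): V => [V V0|V S W irrS chiV [r [F [irrF chiF]]]].
    exists 0%N, (fun _ => V); split=> [[]//|x]; rewrite big_ord0 /chi.
    by rewrite /mxtrace big1 // => i _; have := ltn_ord i; rewrite {2}V0.
  exists r.+1, (fun k => if unlift ord0 k is Some j then F j else S).
  split=> [i|x]; first by case: unliftP.
  rewrite big_ord_recl unlift_none mul1r chiV chiF; congr (_ + _).
  by apply: eq_bigr => j _; rewrite liftK.
have coverF V : irr V -> exists i, chi V =1 chi (F i).
  move=> irrV; apply: boolp.contrapT => noF.
  have := ip_regular V; rewrite (ip_suml _ chiF) big1 => [/esym/eqP|i _].
    by rewrite (negPf (rdim_neq0 irrV)).
  have [->|ipFV] := eqVneq (ip (F i) V) 0; first by rewrite mulr0.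
  by case: noF; exists i; apply: (irr_ip_chi ndT dual_e).
(* The indices at which a character appears for the first time. *)
pose A := [set i : 'I_r | [forall j : 'I_r,
   (j < i)%N ==> ~~ boolp.asbool (chi (F i) =1 chi (F j))]].
have AP i : i \in A -> forall j : 'I_r, (j < i)%N -> ~ chi (F i) =1 chi (F j).
  by rewrite inE => /forallP A_i j ji; have /implyP/(_ ji)/boolp.asboolPn := A_i j.
exists #|A|, (fun k => F (enum_val k)); split=> [i|i j eqij|V irrV] //.
  apply: enum_val_inj; apply: val_inj => /=.
  have [lt_ij|lt_ji|//] := ltngtP (enum_val i) (enum_val j).
    by case: (AP _ (enum_valP j) _ lt_ij) => x; rewrite eqij.
  by case: (AP _ (enum_valP i) _ lt_ji) => x; rewrite eqij.
have [i0 Vi0] := coverF V irrV.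
pose P i := boolp.asbool (chi V =1 chi (F i)).
have Pi0 : P i0 by apply/boolp.asboolP.
case: (arg_minnP (fun i : 'I_r => nat_of_ord i) Pi0) => i /boolp.asboolP Vi mini.
have Ai : i \in A.
  rewrite inE; apply/forallP => j; apply/implyP => ltji.
  apply/boolp.asboolPn => eqij.
  have /mini : P j by apply/boolp.asboolP => x; rewrite Vi.
  by rewrite leqNgt ltji.
by exists (enum_rank_in Ai i); rewrite enum_rankK_in.
Qed.

Lemma chi_decomp s (W : 'I_s -> crep R E) V : complete_family W ->
  exists m : 'I_s -> nat, forall x, chi V x = \sum_i (m i)%:R * chi (W i) x.
Proof.
case=> _ _ coverW.
elim/(@rep_ind R E n e e' ndT dual_e): V => [V V0|V S U irrS chiV [m chiU]].
  exists (fun _ => 0%N) => x; rewrite /chi big1 => [|i _]; last by rewrite mul0r.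
  by rewrite /mxtrace big1 // => i _; have := ltn_ord i; rewrite {2}V0.
have [i Si] := coverW S irrS; exists (fun j => (j == i) + m j)%N => x.
under eq_bigr do rewrite natrD mulrDl; rewrite big_split /= chiV chiU.
congr (_ + _); rewrite (bigD1 i) //= eqxx mul1r big1 ?addr0 // => j ji.
by rewrite (negPf ji) mul0r.
Qed.

Section Sigma.

Variables (s : nat) (W : 'I_s -> crep R E) (sigma : 'I_s -> {rmorphism Z -> R[i]}).
Hypotheses (complW : complete_family W)
           (sigmaP : forall i z, W i (vsval z) = (sigma i z)%:M).

Let irrW i : irr (W i). Proof. by case: complW. Qed.
Local Notation N := (fun i => (rdim (W i))%:R : R[i]).

Lemma ip_family i j : ip (W i) (W j) = (i == j)%:R.
Proof.
have [->|ij] := eqVneq; first exact: irr_ip.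
apply/eqP; apply: contraNT ij => /(irr_ip_chi ndT dual_e (irrW j) (irrW i)).
by case: complW => _ injW _ /injW ->.
Qed.

Lemma ip_coef V (a : 'I_s -> R[i]) j :
  (forall x, chi V x = \sum_i a i * chi (W i) x) -> ip V (W j) = a j.
Proof.
move=> chiV; rewrite (ip_suml _ chiV) (bigD1 j) //= ip_family eqxx mulr1.
by rewrite big1 ?addr0 // => i ij; rewrite ip_family (negPf ij) mulr0.
Qed.

Lemma trace_family x : ratr (T x) = \sum_i N i * chi (W i) x.
Proof.
have [m chiE] := chi_decomp (regular_rep R E) complW.
rewrite -chi_regular chiE; apply: eq_bigr => i _; congr (_ * _).
by rewrite -(ip_coef _ chiE) ip_regular.
Qed.

Definition zproj x : Z := vsproj _ (cproj x).

Lemma zprojE x : vsval (zproj x) = cproj x.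
Proof. by rewrite vsprojK // cprojP. Qed.

Lemma chi_center i z : chi (W i) (vsval z) = N i * sigma i z.
Proof. by rewrite /chi sigmaP mxtrace_scalar mulr_natl. Qed.

Lemma chi_sigma i x : chi (W i) x = N i * sigma i (zproj x).
Proof. by rewrite -chi_center zprojE chi_cproj. Qed.

Lemma trace_sigma z : ratr (T (vsval z)) = \sum_i N i ^+ 2 * sigma i z.
Proof.
by rewrite trace_family; apply: eq_bigr => i _; rewrite chi_center mulrA.
Qed.

(** Composed with [zproj], the embeddings are the characters divided by their dimensions, so a
    relation among them is one among orthonormal characters; pairing with [W j] isolates [a j]. *)
Lemma sigma_indep (a : 'I_s -> R[i]) :
  (forall z, \sum_i a i * sigma i z = 0) -> forall i, a i = 0.
Proof.
move=> a0 j; have Nj := rdim_neq0 (irrW j).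
have : \sum_k (\sum_i a i / N i * chi (W i) (e k)) * chi (W j) (e' k) = 0.
  rewrite big1 // => k _; under eq_bigr => i _ do
    rewrite chi_sigma mulrA divfK ?rdim_neq0 //.
  by rewrite a0 mul0r.
under eq_bigr do rewrite mulr_suml.
have ipE (c : R[i]) i :
    \sum_k c * chi (W i) (e k) * chi (W j) (e' k) = c * (i == j)%:R.
  by rewrite -ip_family mulr_sumr; apply: eq_bigr => k _; rewrite mulrA.
rewrite exchange_big (bigD1 j) //= [X in _ + X]big1 => [|i ij]; last first.
  by rewrite ipE (negPf ij) mulr0.
rewrite addr0 ipE eqxx mulr1 => /eqP.
by rewrite mulf_eq0 invr_eq0 (negPf Nj) orbF => /eqP.
Qed.

Lemma sigmaZ (tau : {rmorphism Z -> R[i]}) q z : tau (q *: z) = ratr q * tau z.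
Proof. exact: (@raddfZ_rat _ _ R[i]^o). Qed.

Lemma sigma_inj i j : sigma i =1 sigma j -> i = j.
Proof.
move=> eq_ij; case: complW => _ injW _; apply: injW.
apply: (irr_center_inj ndT dual_e) => // z Zz.
rewrite -(vsprojK Zz) !chi_center ![N _ * _]mulrC !mulfK ?rdim_neq0 //.
Qed.

Local Notation f := (\dim 'Z({:E})).
Local Notation b := (@center_basis E).

Definition sigma_mx : 'M[R[i]]_(s, f) := \matrix_(i, k) sigma i (b k).

Lemma sigma_mx_free : row_free sigma_mx.
Proof.
rewrite -kermx_eq0; apply/rowV0P => v /sub_kermxP vS0.
apply/rowP => i; rewrite mxE; apply: (sigma_indep (a := fun i => v 0 i)) => z.
rewrite (center_coord z); under eq_bigr do rewrite rmorph_sum mulr_sumr.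
rewrite exchange_big big1 //= => k _.
have := congr1 (fun A : 'rV_f => A 0 k) vS0; rewrite !mxE => vSk.
transitivity (ratr (coord (vbasis 'Z({:E})) k (vsval z)) *
              \sum_j v 0 j * sigma_mx j k); last by rewrite vSk mulr0.
rewrite mulr_sumr; apply: eq_bigr => j _.
by rewrite sigmaZ mulrCA mxE.
Qed.

Lemma trace_cproj x : T (cproj x) = T x.
Proof.
by apply: (@fmorph_inj _ _ (@ratr R[i])); rewrite /= -!(chi_regular R) chi_cproj.
Qed.

(** For central [z], the trace of [z * y] depends only on the central projection of [y], so
    nondegeneracy descends to the center. *)
Lemma center_trace_nondegenerate (z : Z) :
  (forall k, T (vsval z * vsval (b k)) = 0) -> z = 0.
Proof.
move=> z0; apply: subvs_inj; rewrite linear0; apply: ndT => y.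
rewrite -trace_cproj cproj_centerM ?subvsP // -zprojE (center_coord (zproj y)).
rewrite linear_sum mulr_sumr linear_sum big1 //= => k _.
by rewrite -scalerAr linearZ /= z0 mulr0.
Qed.

Definition center_gram : 'M[rat]_f := \matrix_(k, l) T (vsval (b k) * vsval (b l)).

Lemma center_gram_unit : center_gram \in unitmx.
Proof.
rewrite -row_free_unit -kermx_eq0; apply/rowV0P => u /sub_kermxP uG0.
have x0 : \sum_k u 0 k *: b k = 0.
  apply: center_trace_nondegenerate => l.
  have := congr1 (fun A : 'rV_f => A 0 l) uG0; rewrite !mxE => <-.
  rewrite linear_sum mulr_suml linear_sum; apply: eq_bigr => k _ /=.
  by rewrite -scalerAl linearZ mxE.
have /freeP free_b := basis_free (vbasisP 'Z({:E})).
apply/rowP => k; rewrite mxE; apply: (free_b (fun k => u 0 k)).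
transitivity (vsval (\sum_k u 0 k *: b k)); last by rewrite x0 linear0.
by rewrite linear_sum; apply: eq_bigr => j _; rewrite /= center_basisE.
Qed.

(** The Gram matrix of the trace form on the center is a weighted sum of products of entries of
    [sigma_mx], so a vector killed by all [sigma i] is killed by this invertible matrix. With
    [sigma_mx_free] this makes [sigma_mx] square. *)
Lemma sigma_mx_full : row_full sigma_mx.
Proof.
rewrite /row_full -mxrank_tr -/(row_free _) -kermx_eq0.
apply/rowV0P => v /sub_kermxP vS0.
have vS i : \sum_k v 0 k * sigma i (b k) = 0.
  transitivity ((v *m sigma_mx^T) 0 i); last by rewrite vS0 mxE.
  by rewrite mxE; apply: eq_bigr => k _; rewrite !mxE.
have vG : v *m map_mx ratr center_gram = 0.
  apply/rowP => l; rewrite !mxE.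
  transitivity (\sum_k \sum_i N i ^+ 2 * sigma i (b l) * (v 0 k * sigma i (b k))).
    apply: eq_bigr => k _; rewrite !mxE (trace_sigma (b k * b l)) mulr_sumr.
    by apply: eq_bigr => i _; rewrite rmorphM; ring.
  rewrite exchange_big big1 //= => i _.
  by rewrite -mulr_sumr vS mulr0.
have Gu : (map_mx ratr center_gram : 'M[R[i]]_f) \in unitmx.
  by rewrite map_unitmx center_gram_unit.
by rewrite -(mulmxK Gu v) vG mul0mx.
Qed.

Lemma card_family : s = f.
Proof.
by have /eqP <- := sigma_mx_free; have /eqP := sigma_mx_full.
Qed.

(* Dedekind's argument: tau is a combination of the linearly independent sigma_i,
   and multiplicativity forces all but one coefficient to vanish. *)
Lemma all_sigma (tau : {rmorphism Z -> R[i]}) : exists i, sigma i =1 tau.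
Proof.
have /submxP[a aS] : (\row_k tau (b k) <= sigma_mx)%MS.
  by rewrite submx_full ?sigma_mx_full.
have tauE z : tau z = \sum_i a 0 i * sigma i z.
  rewrite {1}(center_coord z) rmorph_sum.
  transitivity (\sum_k \sum_i a 0 i *
      (ratr (coord (vbasis 'Z({:E})) k (vsval z)) * sigma i (b k))).
    apply: eq_bigr => k _; have /rowP/(_ k) := aS; rewrite !mxE sigmaZ => ->.
    by rewrite mulr_sumr; apply: eq_bigr => i _; rewrite mulrCA mxE.
  rewrite exchange_big; apply: eq_bigr => i _ /=; rewrite -mulr_sumr.
  rewrite {2}(center_coord z) rmorph_sum; congr (_ * _); apply: eq_bigr => k _.
  by rewrite sigmaZ.
have az z i : a 0 i * (sigma i z - tau z) = 0.
  apply: (sigma_indep (a := fun i => a 0 i * (sigma i z - tau z))) => z'.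
  have := rmorphM tau z z'; rewrite [LHS]tauE [in RHS](tauE z') mulr_sumr.
  move/eqP; rewrite -subr_eq0 -sumrB => /eqP sum0; rewrite -[RHS]sum0.
  apply: eq_bigr => j _; rewrite rmorphM mulrBr mulrBl mulrA.
  by congr (_ - _); rewrite -!mulrA mulrCA.
have [/forallP a0|] := boolP [forall i, a 0 i == 0].
  have := rmorph1 tau; rewrite tauE big1 => [/esym/eqP|i _].
    by rewrite oner_eq0.
  by rewrite (eqP (a0 i)) mul0r.
rewrite negb_forall => /existsP[i ai]; exists i => z; apply/eqP.
by move/eqP: (az z i); rewrite mulf_eq0 (negPf ai) subr_eq0.
Qed.

(** The sum is the trace of multiplication by [z] on the center: [sigma_mx] diagonalizes its
    rational matrix [M]. *)
Lemma sum_sigma_rat z : exists q : rat, \sum_i sigma i z = ratr q.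
Proof.
pose M : 'M[rat]_f :=
  \matrix_(l, k) coord (vbasis 'Z({:E})%VS) l (vsval (z * b k)).
pose D : 'M[R[i]]_s := diag_mx (\row_i sigma i z).
have DS : D *m sigma_mx = sigma_mx *m map_mx ratr M.
  apply/matrixP => i k; rewrite mul_diag_mx !mxE -rmorphM /=.
  rewrite {1}(center_coord (z * b k)) rmorph_sum; apply: eq_bigr => l _.
  by rewrite sigmaZ !mxE mulrC.
exists (\tr M); transitivity (\tr D).
  by apply: eq_bigr => i _; rewrite !mxE eqxx.
rewrite -[D]mulmx1 -(mulmxVp sigma_mx_free) mulmxA DS mxtrace_mulC mulmxA.
by rewrite mulVpmx ?sigma_mx_full // mul1mx trace_map_mx.
Qed.

Section Simple.

Hypothesis simpleE : simple_algebra E.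

(** The multiples of a central [z] form a two-sided ideal, which by simplicity is all of [E]. *)
Lemma simple_center_unit (z : E) : z \in 'Z({:E})%VS -> z != 0 ->
  exists y, z * y = 1.
Proof.
move=> /mem_centerP cz z_neq0; pose g := amull z.
have gE x : g x = z * x by rewrite lfunE.
case: (simpleE (I := limg g)) => [a x /memv_imgP[u _ ->]|g0|gT].
- rewrite gE; apply/andP; split.
    by rewrite mulrA -cz -mulrA -gE memv_img ?memvf.
  by rewrite -mulrA -gE memv_img ?memvf.
- case/eqP: z_neq0; apply/eqP; rewrite -memv0 -g0 -[z]mulr1 -gE.
  by rewrite memv_img ?memvf.
have /memv_imgP[y _] : 1 \in limg g by rewrite gT memvf.
by rewrite gE; exists y.
Qed.

Lemma sigma_eq0 i z : sigma i z = 0 -> z = 0.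
Proof.
move=> sz0; apply/eqP; apply: contraT => z_neq0.
have z1 : vsval z != 0.
  by apply: contra z_neq0 => /eqP z0; apply/eqP/subvs_inj; rewrite z0 linear0.
have [y zy] := simple_center_unit (subvsP z) z1.
have := congr1 (W i) zy; rewrite repM sigmaP sz0 mul_scalar_mx scale0r rmorph1.
move/(congr1 (@mxtrace _ _)); rewrite mxtrace0 mxtrace1 => /esym/eqP.
by rewrite (negPf (rdim_neq0 (irrW i))).
Qed.

Lemma rational_coef (t : 'I_s -> rat) :
  (forall z, exists q : rat, \sum_i ratr (t i) * sigma i z = ratr q) ->
  forall i j, t i / (rdim (W i))%:R ^+ 2 = t j / (rdim (W j))%:R ^+ 2.
Proof.
move=> /boolp.choice[phi phiE].
pose psi y := phi (zproj y).
have ratrI := @fmorph_inj _ _ (@ratr R[i]).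
have phiD a z z' : phi (a *: z + z') = a * phi z + phi z'.
  apply: ratrI; rewrite rmorphD rmorphM /= -!phiE mulr_sumr -big_split.
  by apply: eq_bigr => i _; rewrite rmorphD /= sigmaZ mulrDr mulrCA.
have psi_lin : scalar psi.
  move=> a x y; rewrite /psi -phiD; congr phi; apply: subvs_inj.
  by rewrite [RHS]linearP /= !zprojE cproj_linear.
pose psi' : {scalar E} :=
  HB.pack psi (GRing.isLinear.Build rat E rat^o *%R psi psi_lin).
have [a' a'E] := trace_representation ndT psi'.
(* The trace form represents the rational functional by some [a']; on the center only its central
   projection counts. *)
pose a := zproj a'.
have phiT z : phi z = T (vsval (z * a)).
  have -> : phi z = psi (vsval z).
    congr phi; apply: subvs_inj; rewrite zprojE cproj_id ?subvsP //.
  by rewrite [LHS]a'E -trace_cproj cproj_centerM ?subvsP // -zprojE.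
have ta i : ratr (t i) = N i ^+ 2 * sigma i a.
  apply/eqP; rewrite -subr_eq0; apply/eqP.
  apply: (sigma_indep (a := fun i => ratr (t i) - N i ^+ 2 * sigma i a)) => z.
  under eq_bigr do rewrite mulrBl; rewrite sumrB phiE phiT trace_sigma.
  apply/eqP; rewrite subr_eq0; apply/eqP; apply: eq_bigr => j _.
  by rewrite rmorphM; ring.
have sa i : sigma i a = ratr (t i / (rdim (W i))%:R ^+ 2).
  rewrite rmorphM fmorphV rmorphXn rmorph_nat /= ta mulrC mulKf //.
  by rewrite expf_neq0 ?rdim_neq0.
move=> i j; apply: ratrI; rewrite -[LHS]sa.
(* The embedding [sigma j] is injective and takes the same rational value on both sides; hence [a]
   is rational and all [sigma i] agree on it. *)
have -> : a = (t j / (rdim (W j))%:R ^+ 2) *: 1.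
  apply/eqP; rewrite -subr_eq0; apply/eqP/(sigma_eq0 (i := j)).
  by rewrite rmorphB /= sigmaZ rmorph1 mulr1 sa subrr.
by rewrite sigmaZ rmorph1 mulr1.
Qed.

Lemma rdim_family i j : rdim (W i) = rdim (W j).
Proof.
have sum_rat z : exists q : rat, \sum_i ratr 1 * sigma i z = ratr q.
  have [q qE] := sum_sigma_rat z; exists q; rewrite -qE.
  by apply: eq_bigr => k _; rewrite rmorph1 mul1r.
have := rational_coef sum_rat i j; rewrite !mul1r => /invr_inj/eqP.
by rewrite -!natrX eqr_nat eqn_exp2r // => /eqP.
Qed.

End Simple.
End Sigma.
End CompleteFamily.

(** * Rational representations *)

Lemma coef_mul_top (F : nzRingType) (p q : {poly F}) m n :
  (size p <= m.+1)%N -> (size q <= n.+1)%N -> (p * q)`_(m + n) = p`_m * q`_n.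
Proof.
move=> sp sq; rewrite coefM (bigD1 (inord m)) //= inordK ?ltnS ?leq_addr //.
rewrite addKn big1 ?addr0 // => j jm.
have [ltjm|ltmj|eqjm] := ltngtP j m; last first.
- by case/eqP: jm; apply: val_inj; rewrite /= inordK ?ltnS ?leq_addr.
- by rewrite (nth_default _ (leq_trans sp ltmj)) mul0r.
rewrite [X in _ * X]nth_default ?mulr0 // (leq_trans sq) //.
by rewrite ltn_subRL ltn_add2r.
Qed.

(* The coefficients are determined from the top: if a is the part of p of degree
   > k, then the coefficient of p^N - a^N at k + (N - 1) deg p is N p_k. *)
Lemma monic_root_rational (F : numFieldType) (p : {poly F}) N (q : {poly rat}) :
    p \is monic -> (0 < N)%N -> p ^+ N = map_poly ratr q ->
  exists p', p = map_poly ratr p'.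
Proof.
move=> mp N_gt0 pN; set d := (size p).-1.
have sp : size p = d.+1 by rewrite prednK // size_poly_gt0 monic_neq0.
have coef_rat k : exists c : rat, p`_k = ratr c.
  (* Descending induction on [k]: the coefficients of higher degree are already known to be
     rational. *)
  have [m] : exists m, (d - k <= m)%N by exists (d - k)%N.
  elim: m k => [|m IHm] k.
    rewrite leqn0 subn_eq0 leq_eqVlt => /orP[/eqP <-|ltdk].
      by exists 1; rewrite rmorph1; apply/eqP; have := mp; rewrite monicE lead_coefE.
    by exists 0; rewrite rmorph0 nth_default ?sp.
  move=> le_m; have [ledk|ltkd] := leqP d k.
    by apply: IHm; move: ledk; rewrite -subn_eq0 => /eqP ->.
  have [c cE] : exists c : nat -> rat, forall j, (k < j)%N -> p`_j = ratr (c j).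
    have /boolp.choice[c cE] j : exists c : rat, (k < j)%N -> p`_j = ratr c.
      have [ltkj|] := ltnP k j; last by exists 0.
      have [|c cE] := IHm j; last by exists c.
      by lia.
    by exists c.
  pose a' := \poly_(j < d.+1) (if (k < j)%N then c j else 0).
  pose a := map_poly ratr a' : {poly F}.
  have aE j : a`_j = if (k < j)%N then p`_j else 0.
    rewrite coef_map coef_poly; case: ltnP => [_|ledj].
      by case: ifP => [/cE -> //|_]; rewrite raddf0.
    by rewrite raddf0; case: ifP => // _; rewrite nth_default ?sp.
  have sa : size a = d.+1.
    apply/eqP; rewrite eqn_leq; apply/andP; split.
      by apply/leq_sizeP => j ledj; rewrite aE; case: ifP => // _; rewrite nth_default ?sp.
    rewrite ltnNge; apply/negP => /leq_sizeP/(_ d (leqnn _)); rewrite aE ltkd.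
    by move: mp; rewrite monicE lead_coefE -/d => /eqP -> /eqP; rewrite oner_eq0.
  have ma : a \is monic.
    by rewrite monicE lead_coefE sa /= aE ltkd; move: mp; rewrite monicE lead_coefE.
  have sb : (size (p - a)%R <= k.+1)%N.
    apply/leq_sizeP => j ltkj; rewrite coefB aE ltkj subrr //.
  (* The cofactor in [p ^+ N - a ^+ N = (p - a) * B]. Its [N] terms are monic of the same degree, so
     its top coefficient is [N], while [p - a] has degree at most [k] with coefficient [p_k]
     there. *)
  pose B := \sum_(i < N) p ^+ (N.-1 - i) * a ^+ i.
  have size_powers m' i : size (p ^+ m' * a ^+ i) = ((m' + i) * d).+1.
    rewrite size_monicM ?monic_neq0 ?rpredX //.
    have := size_exp p m'; have := size_exp a i; rewrite sa sp /=.
    have : (0 < size (p ^+ m'))%N by rewrite size_poly_gt0 monic_neq0 ?rpredX.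
    have : (0 < size (a ^+ i))%N by rewrite size_poly_gt0 monic_neq0 ?rpredX.
    by move: (size (a ^+ i)) (size (p ^+ m')) => x y; rewrite mulnC; nia.
  have size_term (i : 'I_N) : size (p ^+ (N.-1 - i) * a ^+ i) = (N.-1 * d).+1.
    by rewrite size_powers subnK // -ltnS prednK.
  have sB : (size B <= (N.-1 * d).+1)%N.
    apply: leq_trans (size_sum _ _ _) _; apply/bigmax_leqP => i _.
    by rewrite size_term.
  have BN : B`_(N.-1 * d) = N%:R.
    transitivity (\sum_(i < N) 1 : F); last by rewrite sumr_const card_ord.
    rewrite coef_sum; apply: eq_bigr => i _.
    have : p ^+ (N.-1 - i) * a ^+ i \is monic by rewrite rpredM ?rpredX.
    by rewrite monicE lead_coefE size_term => /eqP.
  have := congr1 (fun g : {poly F} => g`_(k + N.-1 * d)) (subrXX p a N).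
  rewrite coef_mul_top // BN !coefB aE ltnn subr0 pN -rmorphXn !coef_map /= => pk.
  exists ((q`_(k + N.-1 * d) - (a' ^+ N)`_(k + N.-1 * d)) / N%:R).
  rewrite rmorphM rmorphB fmorphV rmorph_nat pk mulfK //.
  by rewrite pnatr_eq0 -lt0n.
have /boolp.choice[c cE] := coef_rat.
exists (\poly_(k < d.+1) c k); apply/polyP => k; rewrite coef_map coef_poly.
case: ltnP => [_|ledk]; first exact: cE.
by rewrite raddf0 nth_default ?sp.
Qed.

Section DirectSum2.

Variables (R : realType) (E : falgType rat).
Implicit Types V W : crep R E.

Definition dsum2_fun V W (x : E) : 'M[R[i]]_(rdim V + rdim W) :=
  block_mx (V x) 0 0 (W x).

Fact dsum2_funB V W : zmod_morphism (dsum2_fun V W).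
Proof.
by move=> x y; rewrite /dsum2_fun opp_block_mx add_block_mx !subr0 !rmorphB.
Qed.

Fact dsum2_funM V W : monoid_morphism (dsum2_fun V W).
Proof.
split=> [|x y]; rewrite /dsum2_fun.
  by rewrite !rmorph1; apply: esym (scalar_mx_block _ _ 1).
rewrite -mulmxE mulmx_block !mulmx0 !mul0mx !addr0 !add0r.
by rewrite !repM.
Qed.

Definition dsum2 V W : crep R E := make_rep (dsum2_funB V W) (dsum2_funM V W).

Lemma chi_dsum2 V W x : chi (dsum2 V W) x = chi V x + chi W x.
Proof. exact: mxtrace_block. Qed.

Lemma char_poly_dsum2 V W x :
  char_poly (dsum2 V W x) = char_poly (V x) * char_poly (W x).
Proof.
rewrite /char_poly /char_poly_mx /= /rep_fun /dsum2_fun.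
rewrite map_block_mx !map_mx0 scalar_mx_block opp_block_mx add_block_mx.
by rewrite !oppr0 !addr0 det_ublock.
Qed.

Lemma chi_dsum k (W : 'I_k -> crep R E) x : chi (dsum W) x = \sum_i chi (W i) x.
Proof. exact: mxtrace_mxdiag. Qed.

Lemma chi_copies V k x : chi (copies V k) x = k%:R * chi V x.
Proof. by rewrite chi_dsum sumr_const card_ord mulr_natl. Qed.

Lemma char_poly_iso V W : rep_iso V W ->
  forall x, char_poly (V x) = char_poly (W x).
Proof.
case=> P [Q [PQ QP hP]] x.
have VW : rdim V = rdim W.
  by apply: eq_rdim; apply: chi_iso; exists P, Q.
(* The records are opened so that the dimensions can be identified and [P] becomes a square matrix
   with a determinant. *)
case: V W P Q PQ QP hP VW => [m V] [m' W] /= P Q PQ QP hP eq_m.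
subst m'.
have Pu : P \in unitmx by case/mulmx1_unit: PQ.
have detP : \det (map_mx polyC P) != 0.
  by rewrite det_map_mx polyC_eq0 -unitfE -unitmxE.
apply: (mulIf detP); rewrite [RHS]mulrC -!det_mulmx; congr (\det _).
by rewrite mulmxBl mulmxBr scalar_mxC -!map_mxM hP.
Qed.

End DirectSum2.

(** * The representation V_r and rationality *)

Section Vr.

Variables (R : realType) (E : falgType rat).
Variables (n : nat) (e e' : 'I_n -> E).
Hypotheses (ndT : trace_nondegenerate E) (dual_e : dual_bases e e').
Hypothesis simpleE : simple_algebra E.
Implicit Types V U : crep R E.

Local Notation T := (@regular_trace E).
Local Notation Z := (algebra_center E).
Local Notation f := (\dim 'Z({:E})).

(** The central character of each [W i] is [sigma i]; as these exhaust the embeddings once each and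
    determine irreducible representations, the family is complete. *)
Lemma is_Vr_family V : is_Vr V ->
  exists (sigma : 'I_f -> {rmorphism Z -> R[i]}) (W : 'I_f -> crep R E),
  [/\ complete_family W, forall i z, W i (vsval z) = (sigma i z)%:M
    & forall x, chi V x = \sum_i chi (W i) x].
Proof.
case=> sigma [W [all_sigma simpleW traceW isoV]]; exists sigma, W.
have irrW i : irr (W i) by apply: simple_irr.
have sigmaP i z : W i (vsval z) = (sigma i z)%:M.
  rewrite (irr_center (irrW i)) ?subvsP // /chi.
  (* Evaluating at 1 shows that the multiple [c] is the dimension of [W i]. *)
  have [c cE] := traceW i; have := cE 1.
  rewrite vsval_center1 rmorph1 mxtrace1 rmorph1 mulr1 => Nc.
  by rewrite cE -Nc mulrC mulKf ?rdim_neq0.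
split=> // [|x]; last by rewrite (chi_iso isoV) chi_dsum.
have chiZ i z : chi (W i) (vsval z) / (rdim (W i))%:R = sigma i z.
  exact: chi_scalar (irrW i) (sigmaP i z).
split=> // [i j eq_ij|U irrU].
  have [k [_ uniq_k]] := all_sigma (sigma i).
  rewrite -(uniq_k i) // -(uniq_k j) // => z.
  by rewrite -!chiZ eq_ij (eq_rdim eq_ij).
have [tau tauP] := central_character irrU.
have [i [sigma_i _]] := all_sigma tau; exists i.
apply: (irr_center_inj ndT dual_e) => // z Zz.
by rewrite -(vsprojK Zz) chiZ sigma_i (chi_scalar irrU (tauP _)).
Qed.

Lemma ex_Vr : exists V : crep R E, is_Vr V.
Proof.
have [s [W complW]] := ex_complete_family R ndT dual_e.
have irrW i : irr (W i) by case: complW.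
have [sigma sigmaP] : exists sigma : 'I_s -> {rmorphism Z -> R[i]},
    forall i z, W i (vsval z) = (sigma i z)%:M.
  have /boolp.choice[sigma sigmaP] i := central_character (irrW i).
  by exists sigma.
have sf : s = f := card_family ndT dual_e complW sigmaP.
move: W sigma complW irrW sigmaP; rewrite sf => W sigma complW irrW sigmaP.
exists (dsum W), sigma, W; split=> [tau|i|i|].
- have [i sigma_i] := all_sigma ndT dual_e complW sigmaP tau.
  exists i; split=> // j sigma_j; apply: (sigma_inj ndT dual_e complW sigmaP) => z.
  by rewrite sigma_i sigma_j.
- exact: irr_simple ndT dual_e _ (irrW i).
- by exists (rdim (W i))%:R => z; rewrite sigmaP mxtrace_scalar mulr_natl.
exists 1%:M, 1%:M; split; rewrite ?mulmx1 // => x.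
by rewrite mulmx1 mul1mx.
Qed.

Lemma rational_trace V : rational_rep V -> forall x, exists q, chi V x = ratr q.
Proof.
move=> ratV x; have [p pE] := ratV x; have [V0|V_gt0] := posnP (rdim V).
  exists 0; rewrite rmorph0 /chi /mxtrace big1 // => i _.
  by have := ltn_ord i; rewrite {2}V0.
exists (- p`_(rdim V).-1); rewrite rmorphN /= -coef_map -pE.
by rewrite char_poly_trace // opprK.
Qed.

Section Given.

Variables (Vr : crep R E) (W : 'I_f -> crep R E).
Variable sigma : 'I_f -> {rmorphism Z -> R[i]}.
Hypotheses (complW : complete_family W)
           (sigmaP : forall i z, W i (vsval z) = (sigma i z)%:M)
           (chiVr : forall x, chi Vr x = \sum_i chi (W i) x).

Lemma dim_center_gt0 : (0 < f)%N.
Proof. exact: adim_gt0. Qed.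

Let i0 : 'I_f := Ordinal dim_center_gt0.
Let N := rdim (W i0).

Let rdimW i : rdim (W i) = N.
Proof. exact: (rdim_family ndT dual_e complW sigmaP simpleE). Qed.

Let N_neq0 : N%:R != 0 :> R[i].
Proof. by apply: rdim_neq0; case: complW. Qed.

(** Each [W i] occurs in the regular representation as often as its dimension, and these dimensions
    all equal [N]; so that representation is [N] copies of [Vr]. *)
Lemma chi_Vr_trace x : N%:R * chi Vr x = ratr (T x).
Proof.
rewrite (trace_family ndT dual_e complW) chiVr mulr_sumr.
by apply: eq_bigr => i _; rewrite rdimW.
Qed.

Lemma rdim_Vr : rdim Vr = (f * N)%N.
Proof.
apply/eqP; rewrite -(eqr_nat R[i]) -chi1 chiVr natrM.
under eq_bigr do rewrite chi1 rdimW.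
by rewrite sumr_const card_ord mulr_natl.
Qed.

Lemma dim_algebra : (\dim {:E} = f * N ^ 2)%N.
Proof.
apply/eqP; rewrite -(eqr_nat R[i]) -(@chi1 R E (regular_rep R E)) chi_regular.
by rewrite -chi_Vr_trace chi1 rdim_Vr -natrM mulnCA.
Qed.

Lemma rational_copies V : rational_rep V -> exists k, rep_iso V (copies Vr k).
Proof.
move=> /rational_trace ratV; have [m chiV] := chi_decomp ndT dual_e V complW.
pose t i : rat := (m i * N)%:R.
have trat z : exists q : rat, \sum_i ratr (t i) * sigma i z = ratr q.
  have [q qE] := ratV (vsval z); exists q; rewrite -qE chiV.
  apply: eq_bigr => i _; rewrite (chi_center sigmaP) rdimW rmorph_nat natrM.
  by rewrite mulrA.
have m_const i : m i = m i0.
  have := rational_coef ndT dual_e complW sigmaP simpleE trat i i0.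
  rewrite !rdimW -/N /t => /(mulIf _) H; apply/eqP.
  have N0 : (N > 0)%N by rewrite lt0n -(eqr_nat R[i]).
  have /H/eqP : ((N%:R ^+ 2)^-1 : rat) != 0.
    by rewrite invr_eq0 expf_eq0 /= pnatr_eq0 -lt0n.
  by rewrite eqr_nat eqn_pmul2r.
exists (m i0); apply: (iso_chi ndT dual_e) => x.
rewrite chi_copies chiV chiVr mulr_sumr; apply: eq_bigr => i _.
by rewrite m_const.
Qed.

Lemma chi_regular_Vr x : chi (copies Vr N) x = chi (regular_rep R E) x.
Proof. by rewrite chi_copies chi_Vr_trace chi_regular. Qed.

(** An iterated binary sum, whose characteristic polynomial is a block determinant; it is compared
    with [copies V k] through traces. *)
Lemma ex_char_poly_power V k : exists2 U, forall x, chi U x = k%:R * chi V x &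
  forall x, char_poly (U x) = char_poly (V x) ^+ k.
Proof.
elim: k => [|k [U chiU charU]].
  have hom0 : rep_hom (V := V) (W := V) 0 by move=> x; rewrite mulmx0 mul0mx.
  have [W0 [i [p [hi _ pi ip]]]] := idem_split hom0 (mulmx0 _ _).
  have chi0 x : chi W0 x = 0 by rewrite (chi_split hi pi) ip mul0mx mxtrace0.
  exists W0 => x; first by rewrite chi0 mul0r.
  have W0_0 : rdim W0 = 0%N.
    by apply/eqP; rewrite -(eqr_nat R[i]) -chi1 chi0.
  rewrite expr0 /char_poly; move: (char_poly_mx _); rewrite W0_0 => A.
  exact: det_mx00.
exists (dsum2 V U) => x; first by rewrite chi_dsum2 chiU -natr1 mulrDl mul1r addrC.
by rewrite char_poly_dsum2 charU exprS.
Qed.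

(** The [N]-th power of the characteristic polynomial is that of the regular representation, which
    has rational matrices; a monic root of a rational polynomial is rational. *)
Lemma rational_Vr : rational_rep Vr.
Proof.
move=> x; have [U chiU charU] := ex_char_poly_power Vr N.
apply: (@monic_root_rational _ _ N (char_poly (left_mul_mx x))).
- exact: char_poly_monic.
- by rewrite lt0n -(eqr_nat R[i]).
rewrite -charU map_char_poly; apply: (@char_poly_iso R E U (regular_rep R E)).
by apply: (iso_chi ndT dual_e) => y; rewrite chiU -chi_copies chi_regular_Vr.
Qed.

Lemma rational_copies_Vr k : rational_rep (copies Vr k).
Proof.
move=> x; have [U chiU charU] := ex_char_poly_power Vr k.
have [p pE] := rational_Vr x; exists (p ^+ k).
rewrite rmorphXn /= -pE -charU; apply: (@char_poly_iso R E (copies Vr k) U).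
by apply: (iso_chi ndT dual_e) => y; rewrite chiU chi_copies.
Qed.

End Given.
End Vr.

(** * Polarized representations *)

Lemma eqrN_eq0 (F : numDomainType) (x : F) : x = - x -> x = 0.
Proof.
by move/eqP; rewrite -subr_eq0 opprK -mulr2n mulrn_eq0 => /eqP.
Qed.

Lemma bform_delta (R : realType) m (M : 'M[R[i]]_m) i j :
  bform M (delta_mx i 0) (delta_mx j 0) = M i j.
Proof. by rewrite /bform trmx_delta -rowE -colE !mxE. Qed.

Lemma bformD (R : realType) m (M : 'M[R[i]]_m) v w :
  bform M (v + w) (v + w) =
  bform M v v + bform M v w + (bform M w v + bform M w w).
Proof.
rewrite /bform [(_ + _)^T]raddfD /= !mulmxDl !mulmxDr.
by rewrite [LHS]mxE [X in X + _ = _]mxE [X in _ + X = _]mxE.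
Qed.

Section Polarization.

Variables (R : realType) (E : falgType rat) (star : {linear E -> E}).
Hypothesis posE : positive_involution star.
Implicit Types V W S : crep R E.

Let starM x y : star (x * y) = star y * star x. Proof. by case: posE. Qed.
Let starK : involutive star. Proof. by case: posE. Qed.

Lemma star1 : star 1 = 1.
Proof. by have := starM (star 1) 1; rewrite mulr1 starK mulr1 => <-. Qed.

(** The contragredient representation: [star] restores the order of products that transposition
    reverses. *)
Definition dual_fun V (x : E) : 'M[R[i]]_(rdim V) := (V (star x))^T.

Fact dual_funB V : zmod_morphism (dual_fun V).
Proof. by move=> x y; rewrite /dual_fun linearB rmorphB linearB. Qed.

Fact dual_funM V : monoid_morphism (dual_fun V).
Proof.
split=> [|x y]; rewrite /dual_fun.
  by rewrite star1 rmorph1; apply: trmx1.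
by rewrite starM repM trmx_mul.
Qed.

Definition dual_rep V : crep R E := make_rep (dual_funB V) (dual_funM V).

Lemma chi_dual V x : chi (dual_rep V) x = chi V (star x).
Proof. exact: mxtrace_tr. Qed.

Definition inv_form V (M : 'M[R[i]]_(rdim V)) :=
  forall x, (V x)^T *m M = M *m V (star x).

Lemma inv_form_hom V (M : 'M[R[i]]_(rdim V)) :
  inv_form M <-> rep_hom (V := V) (W := dual_rep V) M.
Proof.
split=> hM x; first by rewrite /= /rep_fun /dual_fun hM starK.
by have := hM (star x); rewrite /= /rep_fun /dual_fun starK => ->.
Qed.

Lemma inv_form_tr V (M : 'M[R[i]]_(rdim V)) : inv_form M -> inv_form M^T.
Proof.
move=> hM x; apply: trmx_inj; rewrite !trmx_mul !trmxK.
by rewrite -{1}[x]starK -hM.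
Qed.

Lemma polarizedP V : polarized_rep star V <->
  exists M : 'M[R[i]]_(rdim V), [/\ M^T = - M, M \in unitmx & inv_form M].
Proof.
split=> [[M [altM ndM invM]]|[M [altM uM invM]]]; exists M; split.
- apply/matrixP => i j; rewrite !mxE; apply/eqP; rewrite -addr_eq0 addrC.
  apply/eqP; rewrite -!bform_delta.
  by have := altM (delta_mx i 0 + delta_mx j 0); rewrite bformD !altM add0r addr0.
- rewrite -row_free_unit -kermx_eq0; apply/rowV0P => u /sub_kermxP uM0.
  apply: trmx_inj; rewrite linear0; apply: ndM => w.
  by rewrite /bform trmxK uM0 mul0mx mxE.
- move=> x; apply/matrixP => i j; rewrite -!bform_delta.
  by have := invM x (delta_mx i 0) (delta_mx j 0); rewrite /bform trmx_mul !mulmxA.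
- move=> v; have AT : (v^T *m M *m v)^T = - (v^T *m M *m v).
    by rewrite !trmx_mul trmxK altM mulNmx mulmxN mulmxA.
  rewrite /bform; move: (v^T *m M *m v) AT => A AT; apply: eqrN_eq0.
  by transitivity (A^T 0 0); [rewrite mxE | rewrite AT mxE].
- move=> v v0; have : v^T *m M = 0.
    apply: mulmx_cV_eq0 => w; apply/matrixP => i j; rewrite !ord1 [RHS]mxE.
    exact: v0.
  by move/(congr1 (mulmx^~ (invmx M))); rewrite mulmxK // mul0mx;
     move/(congr1 trmx); rewrite trmxK trmx0.
by move=> x v w; rewrite /bform trmx_mul -(mulmxA _ _ M) invM !mulmxA.
Qed.

Lemma polarized_iso V W : rep_iso V W -> polarized_rep star V ->
  polarized_rep star W.
Proof.
case=> P [Q [PQ QP hP]] /polarizedP[M [altM uM invM]]; apply/polarizedP.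
exists (P^T *m M *m P); split.
- by rewrite !trmx_mul trmxK altM mulNmx mulmxN mulmxA.
- suff /mulmx1_unit[] : P^T *m M *m P *m (Q *m invmx M *m Q^T) = 1%:M by [].
  rewrite !mulmxA -(mulmxA _ P) PQ mulmx1 mulmxK // -trmx_mul QP trmx1 //.
move=> x; rewrite !mulmxA -trmx_mul -hP trmx_mul -(mulmxA P^T _ M) invM.
by rewrite -!mulmxA hP.
Qed.

Lemma polarized_dsum2 V W : polarized_rep star V -> polarized_rep star W ->
  polarized_rep star (dsum2 V W).
Proof.
move=> /polarizedP[M [altM uM invM]] /polarizedP[M' [altM' uM' invM']].
apply/polarizedP; exists (block_mx M 0 0 M'); split.
- by rewrite tr_block_mx !trmx0 opp_block_mx !oppr0 altM altM'.
- by rewrite unitmxE det_ublock unitrM -!unitmxE uM.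
move=> x; rewrite /= /rep_fun /dsum2_fun tr_block_mx !trmx0 !mulmx_block.
by rewrite !mulmx0 !mul0mx !addr0 !add0r invM invM'.
Qed.

Lemma polarized_hyperbolic V : polarized_rep star (dsum2 V (dual_rep V)).
Proof.
pose M : 'M[R[i]]_(rdim V + rdim V) := block_mx 0 1%:M (- 1%:M) 0.
apply/polarizedP; exists M; split.
- by rewrite tr_block_mx !trmx0 opp_block_mx !oppr0 linearN /= trmx1 opprK.
- suff /mulmx1_unit[] : M *m - M = 1%:M by [].
  rewrite opp_block_mx mulmx_block !oppr0 !mulmx0 !mul0mx !addr0 !add0r opprK.
  by rewrite mulmx1 mulNmx mulmxN mul1mx opprK -scalar_mx_block.
move=> x; rewrite /= /rep_fun /dsum2_fun /= /rep_fun /dual_fun.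
rewrite tr_block_mx !trmx0 trmxK !mulmx_block starK.
by rewrite !mulmx0 !mul0mx !addr0 !add0r mulmxN mulNmx !mulmx1 !mul1mx.
Qed.

Lemma polarized_rdim0 V : rdim V = 0%N -> polarized_rep star V.
Proof.
move=> V0; apply/polarizedP; exists 0; split=> [||x].
- by rewrite trmx0 oppr0.
- by rewrite -row_free_unit /row_free mxrank0 V0.
by rewrite mulmx0 mul0mx.
Qed.

Section Averaging.

Variables (n : nat) (e e' : 'I_n -> E).
Hypotheses (ndT : trace_nondegenerate E) (dual_e : dual_bases e e').
Local Notation ip := (ip e e').

Lemma irr_dual V : irr V -> irr (dual_rep V).
Proof.
case=> V_gt0 scalV; split=> // P hP.
have [|c Pc] := scalV P^T.
  move=> x; apply: trmx_inj; rewrite !trmx_mul trmxK.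
  by have := hP (star x); rewrite /= /rep_fun /dual_fun starK => ->.
by exists c; apply: trmx_inj; rewrite Pc tr_scalar_mx.
Qed.

(** An invariant form is an intertwiner from [V] to its dual; composed with a quasi-inverse it is a
    scalar, nonzero because [M] is. *)
Lemma irr_inv_form_unit V (M : 'M[R[i]]_(rdim V)) :
  irr V -> inv_form M -> M != 0 -> M \in unitmx.
Proof.
move=> irrV /inv_form_hom hM M0; have [G hG MGM] := hom_qinv ndT dual_e hM.
have [_ scalV] := irrV; have [c GMc] := scalV _ (rep_homM hG hM).
have c0 : c != 0.
  apply: contra M0 => /eqP c0; rewrite -MGM -mulmxA GMc c0 -scalemx1 scale0r.
  by rewrite mulmx0.
suff /mulmx1_unit[] : (c^-1 *: G) *m M = 1%:M by [].
by rewrite -scalemxAl GMc scale_scalar_mx mulVf.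
Qed.

Lemma irr_inv_form_scal V (b M : 'M[R[i]]_(rdim V)) :
  irr V -> inv_form b -> b \in unitmx -> inv_form M ->
  M = (\tr (invmx b *m M) / (rdim V)%:R) *: b.
Proof.
move=> irrV hb ub hM; have [_ scalV] := irrV.
have [|c Mc] := scalV (invmx b *m M).
  move=> x; apply: (can_inj (mulKmx ub)); rewrite -[in LHS]mulmxA mulKVmx //.
  rewrite -{1}[x]starK -hM !mulmxA -{2}[x]starK -hb -(mulmxA _ b) mulmxV //.
  by rewrite mulmx1.
rewrite Mc mxtrace_scalar -(mulr_natr c) mulfK ?rdim_neq0 //.
by rewrite -[LHS](mulKVmx ub) Mc mul_mx_scalar.
Qed.

Definition orthogonal_rep V := exists b : 'M[R[i]]_(rdim V),
  [/\ b^T = b, b \in unitmx & inv_form b].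

(** Self-duality yields a nonzero invariant form [b]. Either it is symmetric, or [b - b^T] is a
    nonzero alternating invariant form, hence nondegenerate. *)
Lemma irr_self_dual V : irr V -> (forall x, chi V (star x) = chi V x) ->
  polarized_rep star V \/ orthogonal_rep V.
Proof.
move=> irrV sdV.
have ipV : ip (dual_rep V) V != 0.
  have -> : ip (dual_rep V) V = ip V V.
    by apply: eq_bigr => k _; rewrite chi_dual sdV.
  by rewrite (irr_ip ndT dual_e) ?oner_neq0.
have [b hb b0] : exists2 b : 'M[R[i]]_(rdim V), inv_form b & b != 0.
  have [b hb b0] := (ip_neq0P ndT dual_e _ _).1 ipV.
  by exists b => //; apply/inv_form_hom.
have hbT := inv_form_tr hb.
have [symb|antib] := eqVneq (b - b^T) 0.
  right; exists b; split=> //; last exact: irr_inv_form_unit hb b0.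
  by apply/esym/eqP; rewrite -subr_eq0 symb.
left; apply/polarizedP; exists (b - b^T).
have hB : inv_form (b - b^T).
  by move=> x; rewrite mulmxBl mulmxBr hb hbT.
split=> //; first by rewrite linearB /= trmxK opprB.
exact: irr_inv_form_unit hB antib.
Qed.

Lemma odd_antisym_det0 (F : numDomainType) r (A : 'M[F]_r) :
  A^T = - A -> odd r -> \det A = 0.
Proof.
move=> antiA odd_r; apply: eqrN_eq0; rewrite -{1}det_tr antiA.
by rewrite -scaleN1r detZ -signr_odd odd_r mulN1r.
Qed.

(* The form of V induces on Hom(S, V) a nondegenerate form, alternating because
   the form of S is symmetric. *)
Lemma orthogonal_even V S : polarized_rep star V -> irr S -> orthogonal_rep S ->
  exists r, ip V S = (r.*2)%:R.
Proof.
move=> /polarizedP[M [altM uM invM]] irrS [b [symb ub invb]].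
rewrite (dim_hom_space ndT dual_e); set Q := hom_space _ _ _ _; set r := \rank Q.
suff : ~~ odd r by move=> /even_halfK r2; exists r./2; rewrite r2.
apply/negP => odd_r.
(* The intertwiner from [S] to [V] with coordinates [u]. *)
pose io (u : 'rV_r) : 'M_(rdim V, rdim S) := vec_mx (u *m row_base Q).
have homP (tau : 'M_(rdim V, rdim S)) : rep_hom tau -> exists u, tau = io u.
  move/(hom_spaceP ndT dual_e) => tauQ.
  have /submxP[u uE] : (mxvec tau <= row_base Q)%MS.
    by rewrite eq_row_base; apply/submxP; exists (mxvec tau); rewrite tauQ.
  by exists u; rewrite /io -uE mxvecK.
have hio u : rep_hom (io u).
  apply/(hom_spaceP ndT dual_e); rewrite vec_mxK.
  have /submxP[w ->] : (u *m row_base Q <= Q)%MS.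
    by rewrite mulmx_sub // eq_row_base.
  by rewrite -mulmxA hom_space_idem.
have form_io u v : inv_form ((io u)^T *m M *m io v).
  move=> x; rewrite !mulmxA -trmx_mul hio trmx_mul -(mulmxA (io u)^T _ M) invM.
  by rewrite -!mulmxA hio.
(* Pulling [M] back along two intertwiners gives an invariant form on [S], hence a multiple of [b];
   the factor [c u v] is the induced form. *)
pose c (u v : 'rV_r) := \tr (invmx b *m ((io u)^T *m M *m io v)) / (rdim S)%:R.
have cE u v : (io u)^T *m M *m io v = c u v *: b.
  exact: irr_inv_form_scal.
have b0 : b != 0.
  apply: contraTneq ub => ->; rewrite -row_free_unit /row_free mxrank0 eq_sym.
  by rewrite -lt0n; case: irrS.
have bI (a d : R[i]) : a *: b = d *: b -> a = d.
  move/eqP; rewrite -subr_eq0 -scalerBl scaler_eq0 (negPf b0) orbF subr_eq0.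
  by move/eqP.
pose A : 'M_r := \matrix_(k, l) c (delta_mx 0 k) (delta_mx 0 l).
have anti_c u v : c v u = - c u v.
  have vu : (io v)^T *m M *m io u = - ((io u)^T *m M *m io v)^T.
    by rewrite !trmx_mul trmxK altM mulNmx mulmxN opprK mulmxA.
  by apply: bI; rewrite scaleNr -cE vu cE linearZ /= symb.
have antiA : A^T = - A by apply/matrixP => k l; rewrite !mxE anti_c.
have [u u0 uA] := det0P (introT eqP (odd_antisym_det0 antiA odd_r)).
have io_sum v : io v = \sum_k v 0 k *: io (delta_mx 0 k).
  rewrite {1}(row_sum_delta v) /io mulmx_suml linear_sum; apply: eq_bigr => k _.
  by rewrite -scalemxAl linearZ.
have c_suml w v : c w v = \sum_k w 0 k * c (delta_mx 0 k) v.
  apply: bI; rewrite -cE {1}(io_sum w) linear_sum !mulmx_suml scaler_suml.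
  by apply: eq_bigr => k _; rewrite linearZ -!scalemxAl /= cE scalerA.
have cu0 v : c u v = 0.
  rewrite -[c u v]opprK -anti_c c_suml big1 ?oppr0 // => l _.
  suff -> : c (delta_mx 0 l) u = 0 by rewrite mulr0.
  rewrite -[LHS]opprK -anti_c c_suml.
  transitivity (- (u *m A) 0 l); last by rewrite uA mxE oppr0.
  by rewrite mxE; congr (- _); apply: eq_bigr => k _; rewrite mxE.
(* The adjoint of [io u]. A quasi-inverse of [p] is some [io v], and [p *m io v] is the scalar
   [c u v], which vanishes; so [p] and then [u] would be zero. *)
pose p := invmx b *m ((io u)^T *m M).
have hp : rep_hom (V := V) (W := S) p.
  move=> x; apply: (can_inj (mulKmx ub)); rewrite -[in LHS]mulmxA mulKVmx //.
  rewrite -mulmxA -{1}[x]starK -invM mulmxA -trmx_mul -hio trmx_mul.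
  by rewrite mulmxA -[in RHS](starK x) -invb !mulmxA mulmxK.
have [G hG pGp] := hom_qinv ndT dual_e hp.
have [v Gv] := homP G hG.
have p0 : p = 0.
  by rewrite -pGp Gv /p -(mulmxA (invmx b)) cE cu0 scale0r mulmx0 mul0mx.
case/eqP: u0; apply: (row_free_inj (row_base_free Q)); rewrite mul0mx.
rewrite -[LHS]vec_mxK -/(io u) -[RHS](linear0 mxvec); congr mxvec.
apply: trmx_inj; rewrite trmx0; apply: (can_inj (mulmxK uM)); rewrite mul0mx.
by apply: (can_inj (mulKVmx ub)); rewrite -/p p0 mulmx0.
Qed.

End Averaging.
End Polarization.

(** * Polarizations of V_r and of its multiples *)

Section PolarizedVr.

Variables (R : realType) (E : falgType rat) (star : {linear E -> E}).
Hypotheses (posE : positive_involution star) (simpleE : simple_algebra E).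
Variables (n : nat) (e e' : 'I_n -> E).
Hypotheses (ndT : trace_nondegenerate E) (dual_e : dual_bases e e').
Local Notation ip := (ip e e').
Local Notation Z := (algebra_center E).
Local Notation f := (\dim 'Z({:E})).

Let starK : involutive star. Proof. by case: posE. Qed.

Variables (Vr : crep R E) (W : 'I_f -> crep R E).
Variable sigma : 'I_f -> {rmorphism Z -> R[i]}.
Hypotheses (complW : complete_family W)
           (sigmaP : forall i z, W i (vsval z) = (sigma i z)%:M)
           (chiVr : forall x, chi Vr x = \sum_i chi (W i) x).

Let irrW i : irr (W i). Proof. by case: complW. Qed.

Lemma polarized_chi (V U : crep R E) : chi V =1 chi U -> polarized_rep star V ->
  polarized_rep star U.
Proof. by move=> eqVU; apply: polarized_iso (iso_chi ndT dual_e eqVU). Qed.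

(** Duality acts as an involution [d] on the simple constituents. Fixed ones are polarized by
    hypothesis, exchanged ones pair up into hyperbolic sums, and induction runs over [d]-stable
    index sets. *)
Lemma polarized_Vr_self_dual :
  (forall i, (forall x, chi (W i) (star x) = chi (W i) x) ->
    polarized_rep star (W i)) ->
  polarized_rep star Vr.
Proof.
move=> polW; have [_ injW coverW] := complW.
have /boolp.choice[d dE] i : exists j, chi (dual_rep posE (W i)) =1 chi (W j).
  exact/coverW/irr_dual.
have {}dE i x : chi (W (d i)) x = chi (W i) (star x) by rewrite -dE chi_dual.
have dK : involutive d by move=> i; apply: injW => x; rewrite !dE starK.
suff /(_ setT) [|V polV chiV] : forall A : {set 'I_f},
    (forall i, i \in A -> d i \in A) ->
    exists2 V, polarized_rep star V & forall x, chi V x = \sum_(i in A) chi (W i) x.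
- by move=> i; rewrite !inE.
- apply: polarized_chi polV => x; rewrite chiV chiVr.
  by apply: eq_bigl => i; rewrite inE.
move=> A; have [m] : exists m, (#|A| <= m)%N by exists #|A|.
elim: m A => [|m IHm] A.
  rewrite leqn0 cards_eq0 => /eqP -> _.
  have chi0 x : chi (copies Vr 0) x = 0 by rewrite chi_copies mul0r.
  exists (copies Vr 0); last by move=> x; rewrite big_set0 chi0.
  by apply: polarized_rdim0; apply/eqP; rewrite -(eqr_nat R[i]) -chi1 chi0.
move=> leAm closA; have [->|[i Ai]] := set_0Vmem A.
  by apply: IHm => [|j]; rewrite ?cards0 ?inE.
have [di|di] := eqVneq (d i) i.
  have polWi : polarized_rep star (W i) by apply: polW => x; rewrite -dE di.
  have [||V polV chiV] := IHm (A :\ i).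
  - by rewrite -ltnS (leq_trans _ leAm) // (cardsD1 i A) Ai.
  - move=> j; rewrite !inE => /andP[ji /closA ->]; rewrite andbT.
    by apply: contra ji => /eqP dj; rewrite -[j]dK dj di eqxx.
  exists (dsum2 (W i) V); first exact: polarized_dsum2.
  by move=> x; rewrite chi_dsum2 chiV [in RHS](big_setD1 i).
have [||V polV chiV] := IHm (A :\ i :\ d i).
- rewrite -ltnS (leq_trans _ leAm) // (cardsD1 i A) Ai ltnS.
  by rewrite subset_leq_card // subD1set.
- move=> j; rewrite !inE => /and3P[jdi ji /closA ->]; rewrite andbT.
  apply/andP; split; first by apply: contra ji => /eqP/(can_inj dK) ->; rewrite eqxx.
  by apply: contra jdi => /eqP <-; rewrite dK eqxx.
exists (dsum2 (dsum2 (W i) (dual_rep posE (W i))) V).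
  exact/polarized_dsum2/polV/polarized_hyperbolic.
move=> x; rewrite !chi_dsum2 chiV chi_dual [in RHS](big_setD1 i) //=.
by rewrite [in RHS](big_setD1 (d i)) ?inE ?di ?closA //= dE addrA.
Qed.

(** The multiplicity [k] of [W i] in [V] equals [ip V S], which [orthogonal_even] makes even.
    Separating [S] from [W i] lets an explicit model stand in for [W i]. *)
Lemma orthogonal_constituent V S k i : polarized_rep star V ->
    (forall x, chi V x = k%:R * chi Vr x) ->
    irr S -> chi S =1 chi (W i) -> orthogonal_rep star S ->
  ~~ odd k.
Proof.
move=> polV chiV irrS chiS orthS.
have [r] := orthogonal_even posE ndT dual_e polV irrS orthS.
have -> : ip V S = ip V (W i) by apply: eq_bigr => l _; rewrite chiS.
rewrite (@ip_coef _ _ _ _ _ ndT dual_e _ W complW V (fun _ => k%:R)) => [/eqP|x].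
  by rewrite eqr_nat => /eqP ->; rewrite odd_double.
by rewrite chiV chiVr mulr_sumr.
Qed.

Lemma polarized_odd V k : polarized_rep star V ->
  (forall x, chi V x = k%:R * chi Vr x) -> odd k -> polarized_rep star Vr.
Proof.
move=> polV chiV odd_k; apply: polarized_Vr_self_dual => i sdW.
have [//|orthW] := irr_self_dual posE ndT dual_e (irrW i) sdW.
have := orthogonal_constituent polV chiV (irrW i) (fun=> erefl) orthW.
by rewrite odd_k.
Qed.

(** Up to the factor [N] this character is the regular trace, which [star] preserves; thus [Vr] is
    self-dual and its double is hyperbolic. *)
Lemma chi_Vr_star x : chi Vr (star x) = chi Vr x.
Proof.
have N0 := rdim_neq0 (irrW (Ordinal (dim_center_gt0 E))).
apply: (mulfI N0); rewrite !(chi_Vr_trace ndT dual_e simpleE complW sigmaP chiVr).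
by rewrite (regular_trace_star posE).
Qed.

Lemma polarized_double : polarized_rep star (copies Vr 2).
Proof.
apply: polarized_chi (polarized_hyperbolic posE Vr) => x.
by rewrite chi_dsum2 chi_dual chi_Vr_star chi_copies mulr_natl mulr2n.
Qed.

End PolarizedVr.

(** * Albert types *)

Section HermitianForm.

Variables (R : realType) (E : falgType rat) (star : {linear E -> E}).
Hypothesis posE : positive_involution star.
Implicit Types V : crep R E.

Let starM x y : star (x * y) = star y * star x. Proof. by case: posE. Qed.
Let starK : involutive star. Proof. by case: posE. Qed.
Local Notation ndT := (positive_trace_nondegenerate posE).
Local Notation cj := (map_mx (Num.conj : R[i] -> R[i])).

(** The standard hermitian form is averaged by the Casimir element. In a basis from
    [orthogonal_dual_bases] each diagonal entry is a sum of squared norms with positive weights. *)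
Lemma invariant_hermitian_form V : exists H : 'M[R[i]]_(rdim V),
  (forall i, 0 < H i i) /\ (forall x, (cj (V x))^T *m H = H *m V (star x)).
Proof.
have [e [d [d_gt0 dual_e]]] := orthogonal_dual_bases posE.
set e' := fun k => d k *: star (e k) in dual_e.
pose b y z := (cj (V (star y)))^T *m V z.
exists (\sum_k b (e k) (e' k)); split=> [i|x]; last first.
  rewrite mulmx_sumr mulmx_suml.
  transitivity (\sum_k b (star x * e k) (e' k)).
    apply: eq_bigr => k _; rewrite /b starM starK repM map_mxM trmx_mul.
    by rewrite mulmxA.
  rewrite (@casimirM E ndT _ b) // => [|y u v|u y v|q y z].
  - by apply: eq_bigr => k _; rewrite /b repM mulmxA.
  - by rewrite /b linearB rmorphB map_mxB linearB mulmxBl.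
  - by rewrite /b rmorphB mulmxBr.
  rewrite /b linearZ !repZ map_mxZ linearZ -scalemxAl -scalemxAr /=.
  by rewrite fmorph_rat.
have bE k : b (e k) (e' k) i i =
    ratr (d k) * \sum_l `|V (star (e k)) l i| ^+ 2.
  rewrite /b /e' repZ -scalemxAr !mxE; congr (_ * _).
  by apply: eq_bigr => l _; rewrite !mxE mulrC -normCK.
have b_ge0 k : 0 <= b (e k) (e' k) i i.
  rewrite bE mulr_ge0 ?ler0q ?(ltW (d_gt0 k)) // sumr_ge0 // => l _.
  by rewrite exprn_ge0.
rewrite summxE lt_def sumr_ge0 // andbT psumr_eq0 //; apply/allPn.
apply: boolp.contrapT => all0.
(* If a diagonal entry vanished, column [i] of all [V (e' k)] would be zero, hence also that of
   [V 1]. *)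
have V0 k l : V (star (e k)) l i = 0.
  have /eqP : b (e k) (e' k) i i == 0.
    by apply: contraT => bk; case: all0; exists k; rewrite ?mem_index_enum.
  rewrite bE => /eqP; rewrite mulf_eq0 fmorph_eq0 gt_eqF //= psumr_eq0.
    by move/allP/(_ l (mem_index_enum _)); rewrite sqrf_eq0 normr_eq0 => /eqP.
  by move=> j _; rewrite exprn_ge0.
have := congr1 (fun A : 'M_(rdim V) => A i i) (rmorph1 V).
rewrite {1}(dual_bases_sym ndT dual_e 1) rmorph_sum summxE big1 => [/eqP|k _].
  by rewrite mxE eqxx eq_sym oner_eq0.
by rewrite /e' scalerA repZ mxE V0 mulr0.
Qed.

Lemma central_conj V z c c' : (0 < rdim V)%N -> V z = c%:M -> V (star z) = c'%:M ->
  c' = c^*.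
Proof.
move=> V_gt0 Vz Vz'; have [H [H_gt0 invH]] := invariant_hermitian_form V.
have := invH z; rewrite Vz Vz' map_scalar_mx tr_scalar_mx mul_scalar_mx mul_mx_scalar.
pose i := Ordinal V_gt0.
move/(congr1 (fun A : 'M_(rdim V) => A i i)); rewrite !mxE => /(mulIf _) -> //.
by rewrite gt_eqF.
Qed.

(** For real matrices the hermitian invariance of [H] is bilinear invariance, and [H + H^T] is
    nonzero because its diagonal is positive. *)
Lemma real_rep_orthogonal n (e e' : 'I_n -> E) V : dual_bases e e' -> irr V ->
  (forall x, cj (V x) = V x) -> orthogonal_rep star V.
Proof.
move=> dual_e irrV realV; have [H [H_gt0 invH]] := invariant_hermitian_form V.
have {}invH : inv_form star H by move=> x; rewrite -invH realV.
have invHT := inv_form_tr posE invH.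
exists (H + H^T); split.
- by rewrite linearD /= trmxK addrC.
- apply: (irr_inv_form_unit posE ndT dual_e irrV).
    by move=> x; rewrite mulmxDl mulmxDr invH invHT.
  have [V_gt0 _] := irrV; pose i := Ordinal V_gt0.
  apply: contraTneq (H_gt0 i) => /(congr1 (fun A : 'M_(rdim V) => A i i)).
  by rewrite !mxE => /eqP; rewrite -mulr2n mulrn_eq0 /= => /eqP ->; rewrite ltxx.
by move=> x; rewrite mulmxDl mulmxDr invH invHT.
Qed.

Lemma quaternionic_rep_polarized n (e e' : 'I_n -> E) V (J : 'M[R[i]]_(rdim V)) :
    dual_bases e e' -> irr V -> J *m J = - 1%:M -> J^T = - J ->
    (forall x, cj (V x) = J *m V x *m J^T) ->
  polarized_rep star V.
Proof.
move=> dual_e irrV JJ JT quatV.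
have [H [H_gt0 invH]] := invariant_hermitian_form V.
have JTJ : J^T *m J = 1%:M by rewrite JT mulNmx JJ opprK.
pose b := J^T *m H.
have invb : inv_form star b.
  move=> x; rewrite /b -mulmxA -invH quatV !trmx_mul trmxK !mulmxA JTJ mul1mx.
  by rewrite -!mulmxA.
have invbT := inv_form_tr posE invb.
apply/(polarizedP star); exists (b - b^T).
have inv : inv_form star (b - b^T).
  by move=> x; rewrite mulmxBl mulmxBr invb invbT.
split=> //; first by rewrite linearB /= trmxK opprB.
apply: (irr_inv_form_unit posE ndT dual_e irrV inv).
apply/eqP => /eqP; rewrite subr_eq0 => /eqP bT.
(* If [J^T *m H] were symmetric, then [H = J *m H^T *m J], and [J *m J = - 1%:M] would give [H]
   trace zero against its positive diagonal. *)
have trH : \tr H = - \tr H.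
  have HJ : H = J *m (H^T *m J).
    rewrite -[H in LHS]mul1mx -[1%:M]opprK -JJ -mulmxN -JT -mulmxA.
    by congr (_ *m _); rewrite -[LHS]/b bT trmx_mul trmxK.
  rewrite {1}HJ mxtrace_mulC -mulmxA JJ mulmxN mulmx1.
  by rewrite linearN /= mxtrace_tr.
have [V_gt0 _] := irrV; pose i := Ordinal V_gt0.
have /eqP := eqrN_eq0 trH; rewrite psumr_eq0 => [|k _]; last exact: ltW.
by move/allP/(_ i (mem_index_enum _)); rewrite gt_eqF.
Qed.

End HermitianForm.

Section Transport.

Variables (R : realType) (E : falgType rat).
Implicit Types V W : crep R E.

Lemma irr_iso V W : rep_iso V W -> irr W -> irr V.
Proof.
move=> isoVW [W_gt0 scalW]; split.
  by rewrite (eq_rdim (chi_iso isoVW)).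
case: isoVW => P [Q [PQ QP hP]] A hA.
have hQ x : Q *m V x = W x *m Q.
  by rewrite -[V x]mulmx1 -PQ mulmxA -!mulmxA (mulmxA (V x)) hP !mulmxA QP mul1mx.
have [|c Ac] := scalW (Q *m A *m P).
  by move=> x; rewrite -mulmxA -hP !mulmxA -(mulmxA Q A) hA mulmxA hQ.
exists c; rewrite -[A]mulmx1 -PQ -[A]mul1mx -{1}PQ -!mulmxA (mulmxA A P) (mulmxA Q).
by rewrite (mulmxA Q A) Ac mul_scalar_mx -scalemxAr PQ scalemx1.
Qed.

End Transport.

Lemma raddf_rat_linear (A B : lmodType rat) (f : A -> B) :
  zmod_morphism f -> linear f.
Proof.
move=> fB; pose g : {additive A -> B} :=
  HB.pack f (GRing.isZmodMorphism.Build _ _ f fB).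
move=> a x y; rewrite -[f]/(g : A -> B) raddfD raddfZ_rat /=.
by rewrite /ratr divq_num_den.
Qed.

Lemma dim_bij (K : fieldType) (A B : vectType K) (f : A -> B) :
  linear f -> bijective f -> \dim {:A} = \dim {:B}.
Proof.
move=> f_lin bij_f; pose g : {linear A -> B} :=
  HB.pack f (GRing.isLinear.Build K A B *:%R f f_lin).
have gE x : linfun g x = f x by rewrite lfunE.
have ker0 : lker (linfun g) == 0%VS.
  by apply/lker0P => x y; rewrite !gE; apply: bij_inj.
rewrite -(limg_dim_eq (f := linfun g)) ?(eqP ker0) ?capv0 //; congr (\dim _).
apply/vspaceP => y; rewrite memvf; apply/memv_imgP.
by case: bij_f => h fK hK; exists (h y); rewrite ?memvf // gE hK.
Qed.

(** * The Wedderburn presentation: center and dimension *)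

Section Wedderburn.

Variables (E : falgType rat) (F : fieldExtType rat) (D : falgType F) (n : nat).
Variable g : {rmorphism 'M[D]_n -> E}.
Hypothesis wg : wedderburn g.

Lemma wedderburn_size_gt0 : (0 < n)%N.
Proof.
rewrite lt0n; apply/eqP => n0; have := oner_neq0 E.
rewrite -(rmorph1 g) -(rmorph0 g).
by rewrite (_ : 1 = 0) ?eqxx //; apply/matrixP => i; have := ltn_ord i; rewrite {2}n0.
Qed.

Definition scal_mx (a : F) : 'M[D]_n := (a%:A)%:M.

Lemma scal_mxB : zmod_morphism scal_mx.
Proof. by move=> a b; rewrite /scal_mx scalerBl raddfB. Qed.

Lemma scal_mxM a b : scal_mx (a * b) = scal_mx a * scal_mx b.
Proof. by rewrite /scal_mx -mulmxE -scalar_mxM -scalerAl mul1r scalerA. Qed.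

Lemma scal_mx_inj : injective scal_mx.
Proof.
have i := Ordinal wedderburn_size_gt0.
move=> a b /matrixP/(_ i i); rewrite !mxE eqxx !mulr1n => /eqP.
by rewrite -subr_eq0 -scalerBl scaler_eq0 oner_eq0 orbF subr_eq0 => /eqP.
Qed.

Lemma scal_mx_comm a (X : 'M[D]_n) : scal_mx a * X = X * scal_mx a.
Proof.
apply/matrixP => i j; rewrite -!mulmxE !mxE (bigD1 i) //= [in RHS](bigD1 j) //=.
rewrite !mxE !eqxx !mulr1n !big1 => [|k kj|k ki].
- by rewrite !addr0 -scalerAl -scalerAr mul1r mulr1.
- by rewrite mxE (negPf kj) mulr0n mulr0.
by rewrite mxE eq_sym (negPf ki) mulr0n mul0r.
Qed.

(** Commuting with elementary matrices forces a scalar matrix; commuting with scalar matrices puts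
    its entry in the center of [D], that is in [F]. *)
Lemma wedderburn_center z :
  z \in 'Z({:E})%VS <-> exists a, z = g (scal_mx a).
Proof.
case: wg => _ ZD [h gK hK]; split=> [/mem_centerP cz|[a ->]]; last first.
  by apply/mem_centerP => v; rewrite -(hK v) -!rmorphM scal_mx_comm.
pose X := h z; have cX Y : X * Y = Y * X.
  by apply: (can_inj gK); rewrite !rmorphM hK cz.
pose i0 := Ordinal wedderburn_size_gt0.
have X_delta i j k l : X k i *+ (j == l) = X j l *+ (k == i).
  have /matrixP/(_ k l) := cX (delta_mx i j); rewrite -!mulmxE !mxE.
  rewrite (bigD1 i) //= [in RHS](bigD1 j) //= !mxE !eqxx /= !andbT.
  rewrite !big1 => [|m mj|m mi]; rewrite ?addr0.
  - by rewrite mulr_natr mulr_natl [l == j]eq_sym.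
  - by rewrite mxE (negPf mj) andbF mul0r.
  by rewrite mxE (negPf mi) mulr0.
have Xscal : X = (X i0 i0)%:M.
  apply/matrixP => k l; rewrite mxE.
  have [->|kl] := eqVneq k l.
    by have := X_delta l i0 l i0; rewrite !eqxx.
  by have := X_delta l i0 k i0; rewrite eqxx (negPf kl).
have : X i0 i0 \in 'Z({:D})%VS.
  rewrite memv_cap memvf /=; apply/centvP => y _.
  have /matrixP/(_ i0 i0) := cX y%:M; rewrite Xscal -!mulmxE -!scalar_mxM !mxE.
  by rewrite eqxx.
rewrite ZD => /vlineP[a aE]; exists a.
by rewrite -[LHS]hK -/X Xscal aE.
Qed.

Lemma wedderburn_embedding :
  exists iota : {rmorphism F -> algebra_center E},
    forall a, vsval (iota a) = g (scal_mx a).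
Proof.
pose f a : algebra_center E := vsproj _ (g (scal_mx a)).
have fE a : vsval (f a) = g (scal_mx a).
  by rewrite vsprojK //; apply/wedderburn_center; exists a.
have fB : zmod_morphism f.
  by move=> a b; apply: subvs_inj; rewrite linearB /= !fE scal_mxB rmorphB.
have fM : monoid_morphism f.
  split=> [|a b]; apply: subvs_inj; rewrite fE.
    by rewrite vsval_center1 /scal_mx scale1r rmorph1.
  by rewrite scal_mxM rmorphM /= !fE.
pose f' : {rmorphism F -> algebra_center E} :=
  HB.pack f (GRing.isZmodMorphism.Build _ _ f fB)
            (GRing.isMonoidMorphism.Build _ _ f fM).
by exists f'.
Qed.

Lemma wedderburn_dim_center : \dim 'Z({:E}) = \dim {:F}.
Proof.
have [iota iotaE] := wedderburn_embedding.
have bij_iota : bijective iota.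
  have g_inj : injective g by case: wg => _ _ /bij_inj.
  have surj z : exists a, iota a = z.
    have /wedderburn_center[a za] := subvsP z; exists a.
    by apply: subvs_inj; rewrite iotaE.
  have /boolp.choice[h hE] := surj.
  exists h => [a|z]; last exact: hE.
  by apply: scal_mx_inj; apply: g_inj; rewrite -!iotaE hE.
have := dim_bij (raddf_rat_linear (@rmorphB _ _ iota)) bij_iota.
by rewrite [in X in _ = X -> _]dimvf => ->.
Qed.

Lemma wedderburn_dim : \dim {:E} = (n ^ 2 * \dim {:D} * \dim {:F})%N.
Proof.
case: wg => _ _ bij_g; set m := \dim {:D}; pose b := vbasis {:D}.
pose I : finType := ('I_n * 'I_n * 'I_m)%type.
(* Coordinates over [F] of all matrix entries. An additive bijection between rational vector spaces
   preserves dimension. *)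
pose psi (u : {ffun I -> F}) : E :=
  g (\matrix_(i, j) \sum_k u (i, j, k) *: b`_k).
have psiB : zmod_morphism psi.
  move=> u v; rewrite /psi -rmorphB; congr (g _); apply/matrixP => i j.
  rewrite !mxE -sumrB; apply: eq_bigr => k _.
  by rewrite !ffunE scalerBl.
have bij_psi : bijective psi.
  case: bij_g => h gK hK.
  exists (fun x => [ffun p : I => coord b p.2 (h x p.1.1 p.1.2)]).
    move=> u; apply/ffunP => -[[i j] k]; rewrite ffunE gK mxE /=.
    exact: (coord_sum_free _ _ (basis_free (vbasisP {:D}))).
  move=> x; rewrite -[RHS]hK; congr (g _); apply/matrixP => i j; rewrite mxE.
  rewrite [RHS](coord_vbasis (memvf _)); apply: eq_bigr => k _.
  by rewrite ffunE.
rewrite -(dim_bij (raddf_rat_linear psiB) bij_psi) !dimvf /dim /=.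
by rewrite !card_prod !card_ord -mulnn.
Qed.

End Wedderburn.

(** * Representations of M_n(D) built from representations of D *)

Section Models.

Variables (R : realType) (E : falgType rat) (F : fieldExtType rat).
Variables (D : falgType F) (n : nat) (g : {rmorphism 'M[D]_n -> E}).
Hypothesis wg : wedderburn g.
Local Notation cj := (map_mx (Num.conj : R[i] -> R[i])).

Definition block_diag m (A : 'M[R[i]]_m) : 'M[R[i]]_(\sum_(i < n) m) :=
  \mxdiag_(i < n) A.

Lemma block_diagM m (A B : 'M[R[i]]_m) :
  block_diag A *m block_diag B = block_diag (A *m B).
Proof.
rewrite /block_diag [LHS]mul_mxdiag_mxblock; apply/eq_mxblockP => i j.
by case: eqVneq => _; rewrite ?conform_mx_id ?mulmx0.
Qed.

(** The map [phi] is applied entrywise. The clauses list what passes from [phi] to the model: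
    dimension, real structure, quaternionic structure and central character. *)
Lemma wedderburn_model m (phi : {rmorphism D -> 'M[R[i]]_m}) :
  exists S : crep R E,
  [/\ rdim S = (n * m)%N,
      (forall y, cj (phi y) = phi y) -> forall x, cj (S x) = S x,
      forall j : 'M[R[i]]_m, j *m j = - 1%:M -> j^T = - j ->
        (forall y, cj (phi y) = j *m phi y *m j^T) ->
        exists J : 'M[R[i]]_(rdim S),
          [/\ J *m J = - 1%:M, J^T = - J & forall x, cj (S x) = J *m S x *m J^T]
    & forall a c, phi a%:A = c%:M -> S (g (scal_mx D n a)) = c%:M].
Proof.
case: wg => _ _ [h gK hK].
pose f x : 'M[R[i]]_(\sum_(i < n) m) := \mxblock_(i < n, j < n) phi (h x i j).
have hB x y : h (x - y) = h x - h y.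
  by apply: (can_inj gK); rewrite rmorphB !hK.
have hM x y : h (x * y) = h x *m h y.
  by apply: (can_inj gK); rewrite [RHS]rmorphM !hK.
have h1 : h 1 = 1%:M by apply: (can_inj gK); rewrite hK [RHS]rmorph1.
have fB : zmod_morphism f.
  move=> x y; rewrite /f -mxblockB; apply/eq_mxblockP => i j.
  by rewrite hB !mxE rmorphB.
have f_scal x (c : R[i]) (y : D) : h x = y%:M -> phi y = c%:M -> f x = c%:M.
  move=> hx phiy; rewrite -mxdiagZ; apply/eq_mxblockP => i j.
  rewrite hx mxE; case: eqVneq => [_|_]; first by rewrite mulr1n conform_mx_id phiy.
  by rewrite mulr0n rmorph0.
have fM : monoid_morphism f.
  split=> [|x y]; first by apply: (f_scal 1 1 1); rewrite // rmorph1.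
  rewrite /f -mulmxE mul_mxblock; apply/eq_mxblockP => i j.
  by rewrite hM mxE rmorph_sum; apply: eq_bigr => k _; rewrite rmorphM.
have cjf x : cj (f x) = \mxblock_(i < n, j < n) cj (phi (h x i j)).
  by apply/matrixP => i j; rewrite !mxE.
exists (make_rep fB fM); split=> /=.
- by rewrite sum_nat_const card_ord.
- by move=> real_phi x; rewrite /rep_fun cjf; apply/eq_mxblockP => i j.
- move=> j jj jT quat_phi; exists (block_diag j); split=> [||x].
  + rewrite block_diagM jj /block_diag mxdiagN; congr (- _); exact: mxdiagZ.
  + rewrite /block_diag tr_mxdiag -mxdiagN; apply/eq_mxdiagP => i; exact: jT.
  rewrite /rep_fun cjf /block_diag tr_mxdiag mul_mxdiag_mxblock.
  rewrite mul_mxblock_mxdiag; apply/eq_mxblockP => i k; exact: quat_phi.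
move=> a c phi_a; rewrite /rep_fun; apply: f_scal phi_a.
by rewrite gK.
Qed.

End Models.

Section Matrix2.

Variable A : pzRingType.

Definition mx2 (a b c d : A) : 'M[A]_2 :=
  \matrix_(i, j) if i == 0 then (if j == 0 then a else b)
                 else (if j == 0 then c else d).

Lemma matrix2P (X Y : 'M[A]_2) :
  [/\ X 0 0 = Y 0 0, X 0 1 = Y 0 1, X 1 0 = Y 1 0 & X 1 1 = Y 1 1] -> X = Y.
Proof.
case=> h00 h01 h10 h11; apply/matrixP => i j.
have ord2 (k : 'I_2) : k = 0 \/ k = 1.
  by case: k => [[|[|//]] ltk]; [left | right]; apply: val_inj.
by case: (ord2 i) => ->; case: (ord2 j) => ->.
Qed.

Lemma mx2M a b c d a' b' c' d' : mx2 a b c d *m mx2 a' b' c' d' =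
  mx2 (a * a' + b * c') (a * b' + b * d') (c * a' + d * c') (c * b' + d * d').
Proof.
by apply: matrix2P; split; rewrite !mxE big_ord_recl big_ord1 !mxE.
Qed.

End Matrix2.

(** * Quaternions as complex two by two matrices *)

Section QuaternionMatrix.

Variable R : realType.
Local Notation cj := (map_mx (Num.conj : R[i] -> R[i])).

Definition quat_fst (q : quaternion R) : R[i] := Complex (qc q 0) (qc q 1).
Definition quat_snd (q : quaternion R) : R[i] := Complex (qc q 2) (qc q 3).

(* q = u + v j is sent to its matrix with respect to the basis (1, j). *)
Definition quat_mx (q : quaternion R) : 'M[R[i]]_2 :=
  mx2 (quat_fst q) (quat_snd q) (- (quat_snd q)^*) (quat_fst q)^*.

Lemma quat_fstM p q :
  quat_fst (p * q) = quat_fst p * quat_fst q - quat_snd p * (quat_snd q)^*.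
Proof.
apply/eqP; rewrite eq_complex /= /quat_mul !qcE //=.
by apply/andP; split; apply/eqP; ring.
Qed.

Lemma quat_sndM p q :
  quat_snd (p * q) = quat_fst p * quat_snd q + quat_snd p * (quat_fst q)^*.
Proof.
apply/eqP; rewrite eq_complex /= /quat_mul !qcE //=.
by apply/andP; split; apply/eqP; ring.
Qed.

Lemma quat_mxB : zmod_morphism quat_mx.
Proof.
move=> p q; have qB j : qc (p - q) j = qc p j - qc q j by rewrite /qc !mxE.
have fB : quat_fst (p - q) = quat_fst p - quat_fst q.
  by apply/eqP; rewrite eq_complex /= !qB !eqxx.
have sB : quat_snd (p - q) = quat_snd p - quat_snd q.
  by apply/eqP; rewrite eq_complex /= !qB !eqxx.
by apply: matrix2P; split; rewrite !mxE /= ?fB ?sB ?rmorphB ?opprD.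
Qed.

Lemma quat_mxM : monoid_morphism quat_mx.
Proof.
split=> [|p q].
  have f1 : quat_fst 1 = 1 by rewrite /quat_fst !qcE.
  have s0 : quat_snd 1 = 0 by rewrite /quat_snd !qcE.
  by apply: matrix2P; split; rewrite !mxE /= ?f1 ?s0 ?rmorph1 ?rmorph0 ?oppr0.
rewrite -mulmxE mx2M /quat_mx quat_fstM quat_sndM; congr mx2.
- by rewrite mulrN.
- rewrite rmorphD !rmorphM /= conjCK; ring.
rewrite rmorphB !rmorphM /= conjCK; ring.
Qed.

Definition quat_J : 'M[R[i]]_2 := mx2 0 1 (-1) 0.

Lemma quat_JJ : quat_J *m quat_J = - 1%:M.
Proof.
by rewrite mx2M; apply: matrix2P; split; rewrite !mxE /=; ring.
Qed.

Lemma quat_JT : quat_J^T = - quat_J.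
Proof. by apply: matrix2P; split; rewrite !mxE /= ?oppr0 ?opprK. Qed.

Lemma quat_mx_conj q : cj (quat_mx q) = quat_J *m quat_mx q *m quat_J^T.
Proof.
have -> : quat_J^T = mx2 0 (-1) 1 0 by apply: matrix2P; split; rewrite !mxE.
rewrite !mx2M; apply: matrix2P; split; rewrite !mxE /= ?rmorphN /= ?conjCK; ring.
Qed.

Lemma quat_mxZ1 (a : R) : quat_mx (a *: 1) = (Complex a 0)%:M.
Proof.
have qa j : qc (a *: 1 : quaternion R) j = a * qc 1 j by rewrite qcZ.
have f1 : quat_fst (a *: 1) = Complex a 0.
  by rewrite /quat_fst !qa !qcE //= mulr1 mulr0.
have s1 : quat_snd (a *: 1) = 0 by rewrite /quat_snd !qa !qcE //= mulr0.
apply: matrix2P; split; rewrite !mxE /= ?f1 ?s1 ?rmorph0 ?oppr0 //.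
by apply/eqP; rewrite eq_complex /= oppr0 !eqxx.
Qed.

End QuaternionMatrix.

(** * Polarizability of V_r type by type *)

Section AlbertTypes.

Variables (R : realType) (E : falgType rat) (star : {linear E -> E}).
Hypotheses (simpleE : simple_algebra E) (posE : positive_involution star).
Variables (n0 : nat) (e e' : 'I_n0 -> E).
Hypothesis dual_e : dual_bases e e'.
Local Notation ndT := (positive_trace_nondegenerate posE).
Local Notation Z := (algebra_center E).
Local Notation f := (\dim 'Z({:E})).
Local Notation cj := (map_mx (Num.conj : R[i] -> R[i])).

Variables (Vr : crep R E) (W : 'I_f -> crep R E).
Variable sigma : 'I_f -> {rmorphism Z -> R[i]}.
Hypotheses (complW : complete_family W)
           (sigmaP : forall i z, W i (vsval z) = (sigma i z)%:M)
           (chiVr : forall x, chi Vr x = \sum_i chi (W i) x).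

Let irrW i : irr (W i). Proof. by case: complW. Qed.

Section Given.

Variables (F : fieldExtType rat) (D : falgType F) (n d : nat).
Variable g : {rmorphism 'M[D]_n -> E}.
Hypotheses (wg : wedderburn g) (dD : (d ^ 2 = \dim {:D})%N).

(** The dimension of [E] is computed twice, as [f * N ^ 2] and from the Wedderburn presentation,
    with [f] the degree of [F]. *)
Lemma rdim_wedderburn i : rdim (W i) = (n * d)%N.
Proof.
have := dim_algebra ndT dual_e simpleE complW sigmaP chiVr.
rewrite (rdim_family ndT dual_e complW sigmaP simpleE _ i).
rewrite (wedderburn_dim wg) -dD -expnMn mulnC -(wedderburn_dim_center wg).
move/eqP; rewrite eqn_pmul2l ?dim_center_gt0 // eqn_exp2r // => /eqP.
by [].
Qed.

Lemma rdim_Vr_wedderburn : rdim Vr = (n * d * \dim {:F})%N.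
Proof.
rewrite (rdim_Vr ndT dual_e simpleE complW sigmaP chiVr) rdim_wedderburn.
by rewrite (wedderburn_dim_center wg) mulnC.
Qed.

(** All simple representations have this dimension, so a simple summand of [S] leaves no room for a
    complement. *)
Lemma chi_of_rdim (S : crep R E) : rdim S = (n * d)%N ->
  exists i, chi S =1 chi (W i).
Proof.
move=> dimS; have S_gt0 : (0 < rdim S)%N.
  rewrite dimS -(rdim_wedderburn (Ordinal (dim_center_gt0 E))).
  by case: (irrW (Ordinal (dim_center_gt0 E))).
have [U [i [p [irrU hi hp pi]]]] := irr_split ndT dual_e S_gt0.
have [_ _ coverW] := complW; have [k Uk] := coverW U irrU; exists k => x.
have id_ip : i *m p *m (i *m p) = i *m p by rewrite mulmxA -(mulmxA i) pi mulmx1.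
have [U' [_ [_ [_ _ _ _ chiU']]]] := idem_complement (rep_homM hi hp) id_ip.
have chiS y : chi S y = chi U y + chi U' y.
  by rewrite chiU' (chi_split hi pi) addrC subrK.
have U'0 : rdim U' = 0%N.
  have /eqP := chiS 1; rewrite !chi1 -natrD eqr_nat (eq_rdim Uk).
  by rewrite rdim_wedderburn dimS -{1}[(n * d)%N]addn0 eqn_add2l => /eqP <-.
rewrite chiS Uk [X in _ + X]big1 ?addr0 // => l _.
by have := ltn_ord l; rewrite {2}U'0.
Qed.

Lemma irr_of_rdim (S : crep R E) : rdim S = (n * d)%N -> irr S.
Proof.
move=> dimS; have [i Si] := chi_of_rdim dimS.
exact: irr_iso (iso_chi ndT dual_e Si) (irrW i).
Qed.

Lemma real_model_not_polarized (phi : {rmorphism D -> 'M[R[i]]_d}) :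
  (forall y, cj (phi y) = phi y) -> ~ polarized_rep star Vr.
Proof.
move=> real_phi polVr; have [S [dimS realS _ _]] := wedderburn_model wg phi.
have irrS := irr_of_rdim dimS; have [i Si] := chi_of_rdim dimS.
have orthS := real_rep_orthogonal posE dual_e irrS (realS real_phi).
suff : ~~ odd 1 by [].
apply: (orthogonal_constituent posE ndT dual_e complW chiVr polVr _ irrS Si orthS).
by move=> x; rewrite mul1r.
Qed.

(** Every constituent must be polarized, so a model is asked for each [i]; the condition on scalars
    identifies its central character with [sigma i]. *)
Lemma quaternionic_model_polarized (j : 'M[R[i]]_d) :
    j *m j = - 1%:M -> j^T = - j ->
    (forall i, exists phi : {rmorphism D -> 'M[R[i]]_d},
      (forall y, cj (phi y) = j *m phi y *m j^T) /\
      (forall a z, vsval z = g (scal_mx D n a) -> phi a%:A = (sigma i z)%:M)) ->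
  polarized_rep star Vr.
Proof.
move=> jj jT phiP.
apply: (polarized_Vr_self_dual posE ndT dual_e complW chiVr) => i _.
have [phi [quat_phi phi_sigma]] := phiP i.
have [S [dimS _ quatS scalS]] := wedderburn_model wg phi.
have irrS := irr_of_rdim dimS.
have [J [JJ JT SJ]] := quatS j jj jT quat_phi.
apply: (polarized_chi ndT dual_e _
          (quaternionic_rep_polarized posE dual_e irrS JJ JT SJ)).
apply: (irr_center_inj ndT dual_e) => // z Zz.
have [a za] := (wedderburn_center wg z).1 Zz.
have zE : vsval (vsproj 'Z({:E})%AS z) = z by rewrite vsprojK.
have Sz := scalS _ _ (phi_sigma a (vsproj _ z) (etrans zE za)).
have Wz := sigmaP i (vsproj _ z); rewrite zE in Wz; rewrite -za in Sz.
by rewrite (chi_scalar irrS Sz) (chi_scalar (irrW i) Wz).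
Qed.

End Given.

(** A self-dual [W i] would have [sigma i] invariant under [star], while [central_conj] turns [star]
    into complex conjugation; then [sigma i] would be real on [F]. *)
Lemma type_IV_polarized : type_IV R E -> polarized_rep star Vr.
Proof.
case=> F [D [n [g [wg [imF _]]]]].
apply: (polarized_Vr_self_dual posE ndT dual_e complW chiVr) => i sdW.
have [iota iotaE] := wedderburn_embedding wg.
pose tau : {rmorphism F -> R[i]} := sigma i \o iota.
have [a] := imF tau; rewrite CrealE => /eqP[].
have Zs : star (vsval (iota a)) \in 'Z({:E})%VS.
  have [starM starK _] := posE.
  have /mem_centerP cz := subvsP (iota a); apply/mem_centerP => v.
  by rewrite -(starK v) -!starM cz.
have Wz := sigmaP i (iota a).
have Wz' : W i (star (vsval (iota a))) = (sigma i (iota a))%:M.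
  by rewrite (irr_center (irrW i) Zs) sdW (chi_scalar (irrW i) Wz).
have [W_gt0 _] := irrW i.
by rewrite /= -(central_conj posE W_gt0 Wz Wz').
Qed.

(** A single orthogonal constituent already obstructs a polarization of [Vr], so types I and II need
    only one embedding. *)
Let i0 : 'I_f := Ordinal (dim_center_gt0 E).

Lemma real_embedding (F : fieldExtType rat) (tau : {rmorphism F -> R[i]}) :
  (forall a, tau a \is Num.real) ->
  exists rho : {rmorphism F -> R}, forall a, tau a = Complex (rho a) 0.
Proof.
move=> real_tau; pose r a : R := complex.Re (tau a).
have rE a : tau a = Complex (r a) 0 by rewrite -(RRe_real (real_tau a)).
have rI (x y : R) : Complex x 0 = Complex y 0 -> x = y by case.
have rB : zmod_morphism r.
  by move=> a b; apply: rI; rewrite -rE rmorphB /= !rE; congr Complex; rewrite subrr.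
have rM : monoid_morphism r.
  split=> [|a b]; apply: rI; rewrite -rE ?rmorph1 // rmorphM /= !rE.
  by congr Complex; rewrite !mulr0 ?mul0r ?subr0 ?addr0.
pose rho : {rmorphism F -> R} :=
  HB.pack r (GRing.isZmodMorphism.Build _ _ r rB)
            (GRing.isMonoidMorphism.Build _ _ r rM).
by exists rho.
Qed.

Lemma type_I_not_polarized : type_I R E -> ~ polarized_rep star Vr.
Proof.
case=> F [D [n [g [wg [realF dimD]]]]].
have [iota _] := wedderburn_embedding wg.
pose tau : {rmorphism F -> R[i]} := sigma i0 \o iota.
have DF x : exists a, x = a%:A :> D.
  apply/vlineP; suff -> : <[1 : D]>%VS = {:D}%VS by rewrite memvf.
  by apply/eqP; rewrite eqEdim subvf dimD dim_vline oner_neq0.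
have /boolp.choice[c cE] := DF.
have AI (a b : F) : a%:A = b%:A :> D -> a = b.
  by move/eqP; rewrite -subr_eq0 -scalerBl scaler_eq0 oner_eq0 orbF subr_eq0 => /eqP.
have cB x y : c (x - y) = c x - c y by apply: AI; rewrite -cE scalerBl -!cE.
have cM x y : c (x * y) = c x * c y.
  by apply: AI; rewrite -cE {1}(cE x) {1}(cE y) -scalerAl mul1r scalerA.
have c1 : c 1 = 1 by apply: AI; rewrite -cE scale1r.
pose phi (x : D) : 'M[R[i]]_1 := (tau (c x))%:M.
have phiB : zmod_morphism phi by move=> x y; rewrite /phi cB rmorphB raddfB.
have phiM : monoid_morphism phi.
  split=> [|x y]; first by rewrite /phi c1 rmorph1.
  by rewrite /phi cM rmorphM /= scalar_mxM.
pose phi' : {rmorphism D -> 'M[R[i]]_1} :=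
  HB.pack phi (GRing.isZmodMorphism.Build _ _ phi phiB)
              (GRing.isMonoidMorphism.Build _ _ phi phiM).
apply: (@real_model_not_polarized F D n 1 g wg _ phi'); first by rewrite dimD.
move=> y; rewrite /= /phi map_scalar_mx; congr (_%:M); apply/eqP.
by rewrite -CrealE; apply: realF.
Qed.

Lemma type_II_not_polarized : type_II R E -> ~ polarized_rep star Vr.
Proof.
case=> F [D [n [g [wg [realF dimD bcD]]]]].
have [iota _] := wedderburn_embedding wg.
pose tau : {rmorphism F -> R[i]} := sigma i0 \o iota.
have [rho rhoE] := real_embedding (realF tau).
have [phi _] := bcD rho.
pose psi : {rmorphism D -> 'M[R[i]]_2} := map_mx (real_complex R) \o phi.
apply: (@real_model_not_polarized F D n 2 g wg _ psi); first by rewrite dimD.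
move=> y; apply/matrixP => k l; rewrite !mxE.
exact: conjc_real.
Qed.

Lemma type_III_polarized : type_III R E -> polarized_rep star Vr.
Proof.
case=> F [D [n [g [wg [realF dimD bcD]]]]].
have [iota iotaE] := wedderburn_embedding wg.
apply: (@quaternionic_model_polarized F D n 2 g wg _ (quat_J R)).
- by rewrite dimD.
- exact: quat_JJ.
- exact: quat_JT.
move=> i; pose tau : {rmorphism F -> R[i]} := sigma i \o iota.
have [rho rhoE] := real_embedding (realF tau).
have [phi [phiZ _]] := bcD rho.
pose q : {rmorphism quaternion R -> 'M[R[i]]_2} :=
  HB.pack (@quat_mx R) (GRing.isZmodMorphism.Build _ _ _ (@quat_mxB R))
                       (GRing.isMonoidMorphism.Build _ _ _ (@quat_mxM R)).
pose psi : {rmorphism D -> 'M[R[i]]_2} := q \o phi.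
exists psi; split=> [y|a z za]; first exact: quat_mx_conj.
have -> : z = iota a by apply: subvs_inj; rewrite iotaE.
by rewrite /= phiZ rmorph1 quat_mxZ1 -rhoE.
Qed.

End AlbertTypes.

(** Each of the two is a multiple of the other; comparing positive dimensions, both multiplicities
    are 1. *)
Lemma is_Vrp_unique (R : realType) (E : falgType rat) (star : {linear E -> E})
    n (e e' : 'I_n -> E) (V W : crep R E) :
    trace_nondegenerate E -> dual_bases e e' -> (0 < rdim V)%N ->
  is_Vrp star V -> is_Vrp star W -> rep_iso W V.
Proof.
move=> ndT dual_e V_gt0 [ratV polV univV] [ratW polW univW].
have [k /chi_iso Wk] := univV W ratW polW; have [l /chi_iso Vl] := univW V ratV polV.
have : (rdim V == l * k * rdim V)%N.
  rewrite -(eqr_nat R[i]) !natrM -!chi1 {1}Vl chi_copies Wk chi_copies.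
  by rewrite mulrA.
rewrite -{1}[rdim V]mul1n eqn_pmul2r // eq_sym muln_eq1 => /andP[_ /eqP k1].
by apply: (iso_chi ndT dual_e) => x; rewrite Wk chi_copies k1 mul1r.
Qed.

Theorem mainTheorem8 (R : realType) (E : falgType rat) (star : {linear E -> E})
    (simpleE : simple_algebra E) (posE : positive_involution star) :
  (exists Vr : crep R E, is_Vr Vr) /\
  forall Vr : crep R E, is_Vr Vr ->
    (forall V : crep R E, rational_rep V -> exists k : nat, rep_iso V (copies Vr k)) /\
    (forall (F : fieldExtType rat) (D : falgType F) (n d : nat)
            (g : {rmorphism 'M[D]_n -> E}),
       wedderburn g -> (d ^ 2 = \dim {:D})%N ->
       rdim Vr = (n * d * \dim {:F})%N) /\
    exists Vrp : crep R E,
      is_Vrp star Vrp /\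
      (forall W : crep R E, is_Vrp star W -> rep_iso W Vrp) /\
      (type_III R E \/ type_IV R E -> rep_iso Vrp Vr) /\
      (type_I R E \/ type_II R E -> rep_iso Vrp (copies Vr 2)).
Proof.
have ndT := positive_trace_nondegenerate posE.
have [e [c [_ dual_e]]] := orthogonal_dual_bases posE.
split=> [|Vr VrP]; first exact: ex_Vr ndT dual_e.
have [sigma [W [complW sigmaP chiVr]]] := is_Vr_family ndT dual_e VrP.
have rat_copies := rational_copies ndT dual_e simpleE complW sigmaP chiVr.
split=> //; split=> [F D n d g wg dD|].
  exact: (rdim_Vr_wedderburn simpleE posE dual_e complW sigmaP chiVr wg dD).
have Vr_gt0 : (0 < rdim Vr)%N.
  rewrite (rdim_Vr ndT dual_e simpleE complW sigmaP chiVr) muln_gt0 dim_center_gt0.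
  by case: complW => /(_ (Ordinal (dim_center_gt0 E)))[].
have refl (V : crep R E) : rep_iso V V by apply: (iso_chi ndT dual_e).
(* The choice of [Vrp] depends on whether [Vr] is polarized and not on a classification into types;
   the types enter only to exclude one of the two cases. *)
have [polVr|npolVr] := boolp.pselect (polarized_rep star Vr).
  have VrpP : is_Vrp star Vr.
    split=> // [|V ratV _]; last exact: rat_copies.
    exact (rational_Vr ndT dual_e simpleE complW sigmaP chiVr).
  exists Vr; split=> //; split.
    by move=> V; apply: (is_Vrp_unique ndT dual_e Vr_gt0 VrpP).
  split=> // -[typeI|typeII].
    by case: (type_I_not_polarized simpleE posE dual_e complW sigmaP chiVr typeI).
  by case: (type_II_not_polarized simpleE posE dual_e complW sigmaP chiVr typeII).
have VrpP : is_Vrp star (copies Vr 2).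
  split=> [||V ratV polV].
  - exact (rational_copies_Vr ndT dual_e simpleE complW sigmaP chiVr 2).
  - exact: (polarized_double posE simpleE ndT dual_e complW sigmaP chiVr).
  have [k /chi_iso Vk] := rat_copies V ratV.
  have {}Vk x : chi V x = k%:R * chi Vr x by rewrite Vk chi_copies.
  (* An odd multiple of [Vr] that is polarized would make [Vr] itself polarized. *)
  have even_k : ~~ odd k.
    apply/negP => odd_k; apply: npolVr.
    exact: (polarized_odd posE ndT dual_e complW chiVr polV Vk odd_k).
  exists k./2; apply: (iso_chi ndT dual_e) => x.
  by rewrite !chi_copies Vk mulrA -natrM muln2 even_halfK.
exists (copies Vr 2); split=> //; split.
  move=> V; apply: (is_Vrp_unique ndT dual_e _ VrpP).
  by rewrite -(ltr_nat R[i]) -chi1 chi_copies chi1 -natrM ltr_nat muln_gt0.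
split=> // -[typeIII|typeIV].
  by case: npolVr; exact: (type_III_polarized simpleE posE dual_e complW sigmaP chiVr).
by case: npolVr; exact: (type_IV_polarized posE dual_e complW sigmaP chiVr).
Qed.
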